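(* Let $w=\{w_k\}_{k\in\mathbb{Z}}$ be complex numbers with $\overline{w_{-k}}=w_k$ for all $k$ and $|w_k|<\frac{C}{|k|^3}$ for all $k\ne0$ and some constant $C$, and let $\{v_n\}_{n\in\mathbb{Z}}$ be a bounded real sequence. Let $H$ be the self-adjoint operator on $\ell^2(\mathbb{Z})$ given by $(Hu)_n=\sum_{k\in\mathbb{Z}}w_ku_{n+k}+v_nu_n$. If $S\subset\mathbb{R}$ is a set of positive Lebesgue measure such that for every $E\in S$ the equation $Hu=Eu$ admits a nontrivial bounded solution $u=\{u_n\}_{n\in\mathbb{Z}}$, then $S$ is contained in the essential support of the absolutely continuous spectrum of $H$.
   Context: The essential support of the absolutely continuous spectrum of $H$ is the measurable set $M\subset\mathbb{R}$, defined up to Lebesgue null sets, such that the absolutely continuous part of a maximal spectral measure of $H$ is mutually absolutely continuous with Lebesgue measure restricted to $M$. Containment in $M$ is understood up to a set of Lebesgue measure zero. Solutions of $Hu=Eu$ are not required to be in $\ell^2(\mathbb{Z})$; the equation is $(Hu)_n=Eu_n$ for all $n\in\mathbb{Z}$. *)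

(* Defs.v *)
From HB Require Import structures.
From mathcomp Require Import all_boot all_order all_algebra.
From mathcomp Require Import complex.
From mathcomp Require Import all_classical all_reals all_analysis.

Set Implicit Arguments.
Unset Strict Implicit.
Unset Printing Implicit Defensive.

Import Order.TTheory GRing.Theory Num.Theory.
Import numFieldNormedType.Exports.

Local Open Scope classical_set_scope.
Local Open Scope ring_scope.
Local Open Scope complex_scope.

(* The modulus of a complex number, with values in R. (The norm `|z| provided
   by the numClosedFieldType structure takes its values in R[i].) *)
Definition cmod (R : realType) (z : R[i]) : R := ComplexField.Normc.normc z.

(* Sums over all integers. They are the unconditional sums of absolutely
   summable families: every family summed below is absolutely summable, and the
   value is junk (because of fine) otherwise. *)
Definition zsumR (R : realType) (f : int -> R) : R :=
  fine (\esum_(k in [set: int]) (EFin \o f)^\+ k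
        - \esum_(k in [set: int]) (EFin \o f)^\- k)%E.

Definition zsum (R : realType) (f : int -> R[i]) : R[i] :=
  zsumR (fun k => complex.Re (f k)) +i* zsumR (fun k => complex.Im (f k)).

Definition ell2 (R : realType) (u : int -> R[i]) : Prop :=
  (\esum_(n in [set: int]) (cmod (u n) ^+ 2)%:E < +oo)%E.

Definition inner (R : realType) (u v : int -> R[i]) : R[i] :=
  zsum (fun n => u n * conjc (v n)).

(* The formula makes sense for every bounded u when w is summable; the
   operator H of the theorem is its restriction to ell2. *)
Definition long_range_op (R : realType) (w : int -> R[i]) (v : int -> R)
    (u : int -> R[i]) (n : int) : R[i] :=
  zsum (fun k => w k * u (n + k)) + (v n)%:C * u n.

Section SpectralMeasures.
Context {R : realType}.
Implicit Types (P : set R -> (int -> R[i]) -> (int -> R[i])).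
Implicit Types (H : (int -> R[i]) -> (int -> R[i])).
Implicit Types (mu nu : {finite_measure set (measurableTypeR R) -> \bar R}).

(* mu is the measure A |-> <P(A) u, u>. *)
Definition is_spectral_measure P (u : int -> R[i]) mu : Prop :=
  forall A : set (measurableTypeR R), measurable A ->
    inner (P A u) u = (fine (mu A))%:C.

(* Resolutions of the identity on ell2, indexed by the Borel subsets of R: the
   operators P(A) act on ell2, and what P does outside ell2 or on non-Borel
   sets is irrelevant. Idempotence is pvm_setI with A = B. *)
Record projection_valued_measure P : Prop := {
  pvm_ell2 : forall (A : set (measurableTypeR R)) u,
    measurable A -> ell2 u -> ell2 (P A u) ;
  pvm_linear : forall (A : set (measurableTypeR R)) (a : R[i]) u v,
    measurable A -> ell2 u -> ell2 v ->
    P A (fun n => a * u n + v n) = (fun n => a * P A u n + P A v n) ;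
  pvm_selfadjoint : forall (A : set (measurableTypeR R)) u v,
    measurable A -> ell2 u -> ell2 v -> inner (P A u) v = inner u (P A v) ;
  pvm_set0 : forall u, ell2 u -> P set0 u = (fun=> 0) ;
  pvm_setT : forall u, ell2 u -> P setT u = u ;
  pvm_setI : forall (A B : set (measurableTypeR R)) u,
    measurable A -> measurable B -> ell2 u -> P (A `&` B) u = P A (P B u) ;
  pvm_measure : forall u, ell2 u -> exists mu, is_spectral_measure P u mu
}.

(* H = \int x dP(x) for an everywhere defined H on ell2: every u in ell2 lies
   in the domain {u | \int x^2 d<P u, u> < +oo} of the integral, and the two
   quadratic forms agree (hence so do the operators, by polarization). *)
Definition spectral_resolution H P : Prop :=
  projection_valued_measure P /\
  forall u mu, ell2 u -> is_spectral_measure P u mu ->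
    (\int[mu]_x (x ^+ 2)%:E < +oo)%E /\
    inner (H u) u = (Rintegral mu setT (fun x => x))%:C.

Definition maximal_spectral_measure H mu : Prop :=
  exists P (phi : int -> R[i]),
    [/\ spectral_resolution H P, ell2 phi, is_spectral_measure P phi mu &
        forall psi nu, ell2 psi -> is_spectral_measure P psi nu -> nu `<< mu].

(* mu_ac is the first term of the Lebesgue decomposition of mu. *)
Definition is_ac_part mu
    (mu_ac : {measure set (measurableTypeR R) -> \bar R}) : Prop :=
  exists mu_s : {measure set (measurableTypeR R) -> \bar R},
    [/\ forall A : set (measurableTypeR R), measurable A ->
          mu A = (mu_ac A + mu_s A)%E,
        mu_ac `<< (@lebesgue_measure R) &
        exists N : set (measurableTypeR R),
          [/\ measurable N, lebesgue_measure N = 0%E & mu_s (~` N) = 0%E]].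

(* The domain of completed_lebesgue_measure, equal to the completion of the
   Borel sigma-algebra; [measurable] on R means Borel. *)
Definition lebesgue_measurable (A : set R) : Prop :=
  ((wlength idfun)^*)%mu.-cara.-measurable A.

(* M is a version of the essential support of the absolutely continuous
   spectrum: it is determined up to Lebesgue null sets only, and all maximal
   spectral measures of H give the same class. *)
Definition is_ac_essential_support H (M : set R) : Prop :=
  lebesgue_measurable M /\
  exists mu (mu_ac : {measure set (measurableTypeR R) -> \bar R}),
    [/\ maximal_spectral_measure H mu, is_ac_part mu mu_ac &
        forall A : set (measurableTypeR R), measurable A ->
          (mu_ac A = 0%E <-> completed_lebesgue_measure (A `&` M) = 0%E)].

End SpectralMeasures.

(* Main.v *)
(* Cutting a bounded solution u of H u = E u off at scale L gives a vector psi
   with |psi|^2 = O(L) and, since |k| |w_k| is summable,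
   |(H - E) psi|^2 = O(1/L). Expanding u_n = <psi, delta_n> over spectral annuli
   around E bounds |u_n|^2 by the density of the spectral measure mu_n of
   delta_n at E, so if every mu_n has zero density at E then u = 0.
   Off M and off the Lebesgue null set carrying the singular part there is no
   spectral mass at all, and by Vitali covering a finite measure has zero density
   at almost every point of a set it does not charge. Hence almost every point
   of S lies in M. *)
Require Import Defs.
From HB Require Import structures.
From mathcomp Require Import all_boot all_order all_algebra.
From mathcomp Require Import complex.
From mathcomp Require Import all_classical all_reals all_analysis.
From mathcomp Require Import measurable_realfun.
From mathcomp Require Import ring lra zify.

Set Implicit Arguments.
Unset Strict Implicit.
Unset Printing Implicit Defensive.

Import Order.TTheory GRing.Theory Num.Theory.
Import numFieldNormedType.Exports.

Local Open Scope classical_set_scope.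
Local Open Scope ring_scope.
Local Open Scope complex_scope.

(** * Absolutely summable families over the integers *)

(** The exponents balance as follows. If mu_n has density at most d below a fixed radius, the window
    |x - E| < 1/L contributes to |u_n|^2 at most O(L) * d/L. An annulus at distance r contributes
    O(1/(L r^2)) * O(d r) = O(d/(L r)), so over dyadic r the square roots form a geometric series.
    What lies beyond the fixed radius is O(1/L). A residual larger than O(1/L) would break all but
    the first of these bounds. The operator is accessible only through its quadratic form on each
    spectral measure, without a functional calculus. The decay of P(A) psi at distance r from E is
    therefore extracted from a first moment, once H is known to have no matrix elements between the
    ranges of P(A) and P(~A). A first moment is blind to cancellation between the two sides of E,
    hence every annulus is cut into a left and a right half. Countably many sites n suffice to
    detect u, so their exceptional sets of energies unite to a null set. *)

Section AbsoluteSums.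
Context {R : realType}.
Implicit Types (f g : int -> R) (c : R).

Lemma esumZl (T : choiceType) (I : set T) c (a : T -> \bar R) :
  0 <= c -> (forall i, 0 <= a i)%E ->
  (\esum_(i in I) (c%:E * a i) = c%:E * \esum_(i in I) a i)%E.
Proof.
have le_esumZ c' (b : T -> \bar R) : 0 <= c' -> (forall i, 0 <= b i)%E ->
    (\esum_(i in I) (c'%:E * b i) <= c'%:E * \esum_(i in I) b i)%E.
  move=> c0 b0; apply: ge_ereal_sup => _ [F FI] <-.
  rewrite -ge0_mule_fsumr//.
  by apply: lee_wpmul2l; [rewrite lee_fin|apply: ereal_sup_ubound; exists F].
rewrite le_eqVlt => /predU1P[<-|c0] a0.
  by rewrite mul0e esum1// => i _; rewrite mul0e.
apply/eqP; rewrite eq_le (le_esumZ _ _ (ltW c0))//= -lee_pdivlMl//.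
rewrite [leLHS](_ : _ = \esum_(i in I) (c^-1%:E * (c%:E * a i)))%E.
  apply: le_esumZ; first by rewrite invr_ge0 ltW.
  by move=> i; rewrite mule_ge0// lee_fin ltW.
by apply: eq_esum => i _; rewrite muleA -EFinM mulVf ?mul1e// gt_eqF.
Qed.

Lemma esum_exchange (T1 T2 : choiceType) (a : T1 -> T2 -> \bar R) :
  (forall i j, 0 <= a i j)%E ->
  (\esum_(i in [set: T1]) \esum_(j in [set: T2]) a i j =
   \esum_(j in [set: T2]) \esum_(i in [set: T1]) a i j)%E.
Proof.
move=> a0; rewrite !esum_esum//.
rewrite (reindex_esum [set: T2 * T1] _ (fun x => (x.2, x.1))).
  by rewrite (_ : _ `*`` _ = setT)//; apply/seteqP; split.
split => //.
- by move=> [i1 j1] [i2 j2] _ _ [-> ->].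
- by move=> [i j] _; exists (j, i).
Qed.

Definition abs_summable f := summable [set: int] (EFin \o f).

Lemma abs_summableE f :
  abs_summable f = (\esum_(k in [set: int]) `|f k|%:E < +oo)%E.
Proof. by []. Qed.

Lemma abs_summable_le f g :
  (forall k, `|f k| <= g k) -> abs_summable g -> abs_summable f.
Proof.
move=> fg; apply: le_lt_trans; apply: le_esum => k _ /=.
by rewrite lee_fin (le_trans (fg k))// ler_norm.
Qed.

Lemma abs_summable0 : abs_summable (fun=> 0).
Proof. by rewrite abs_summableE esum1 ?ltry// => k _; rewrite normr0. Qed.

Lemma abs_summableD f g :
  abs_summable f -> abs_summable g -> abs_summable (fun k => f k + g k).
Proof. exact: summableD. Qed.

Lemma abs_summableN f : abs_summable f -> abs_summable (fun k => - f k).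
Proof. by apply: le_lt_trans; apply: le_esum => k _ /=; rewrite normrN. Qed.

Lemma abs_summableZ c f : abs_summable f -> abs_summable (fun k => c * f k).
Proof.
rewrite !abs_summableE => sf.
under eq_esum do rewrite normrM EFinM.
by rewrite esumZl ?lte_mul_pinfty ?lee_fin// => k; rewrite lee_fin.
Qed.

Lemma abs_summable_norm f : abs_summable f -> abs_summable (fun k => `|f k|).
Proof. by apply: le_lt_trans; apply: le_esum => k _ /=; rewrite normr_id. Qed.

Lemma abs_summable_fin_num f : (forall k, 0 <= f k) -> abs_summable f ->
  (\esum_(k in [set: int]) (f k)%:E)%E \is a fin_num.
Proof.
move=> f0; rewrite abs_summableE; under eq_esum do rewrite ger0_norm//.
by rewrite ge0_fin_numE// esum_ge0// => k _; rewrite lee_fin.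
Qed.

(** The supports of [f] and [g] may overlap, unlike those of the positive and negative parts in
    [zsumR]. This freedom is what makes signed sums additive below. *)
Lemma zsumRB_ge0 f g : (forall k, 0 <= f k) -> (forall k, 0 <= g k) ->
  abs_summable f -> abs_summable g ->
  zsumR (fun k => f k - g k) =
  fine (\esum_(k in [set: int]) (f k)%:E) -
  fine (\esum_(k in [set: int]) (g k)%:E).
Proof.
move=> f0 g0 sf sg; rewrite /zsumR.
rewrite (_ : EFin \o _ = (EFin \o f) \- (EFin \o g))%E//.
rewrite esumB//; [|by move=> k _; rewrite lee_fin..].
by rewrite fineB//; exact: abs_summable_fin_num.
Qed.

Lemma zsumR_ge0E f : (forall k, 0 <= f k) ->
  zsumR f = fine (\esum_(k in [set: int]) (f k)%:E).
Proof.
move=> f0; rewrite /zsumR [X in (_ - X)%E]esum1; last first.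
  by move=> k _; rewrite funenegE max_r//= lee_fin oppr_le0.
rewrite sube0; congr fine; apply: eq_esum => k _.
by rewrite funeposE max_l// lee_fin.
Qed.

Lemma esum_zsumR f : (forall k, 0 <= f k) -> abs_summable f ->
  (\esum_(k in [set: int]) (f k)%:E = (zsumR f)%:E)%E.
Proof.
by move=> f0 sf; rewrite zsumR_ge0E// fineK//; exact: abs_summable_fin_num.
Qed.

Lemma zsumRB_pos f g : (forall k, 0 <= f k) -> (forall k, 0 <= g k) ->
  abs_summable f -> abs_summable g ->
  zsumR (fun k => f k - g k) = zsumR f - zsumR g.
Proof. by move=> *; rewrite zsumRB_ge0// !zsumR_ge0E. Qed.

Lemma zsumRD_pos f g : (forall k, 0 <= f k) -> (forall k, 0 <= g k) ->
  abs_summable f -> abs_summable g ->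
  zsumR (fun k => f k + g k) = zsumR f + zsumR g.
Proof.
move=> f0 g0 sf sg; apply: EFin_inj; rewrite EFinD -!esum_zsumR//.
- by rewrite -esumD// => k _; rewrite lee_fin.
- by move=> k; rewrite addr_ge0.
- exact: abs_summableD.
Qed.

Let pos f k := Num.max (f k) 0.
Let neg f k := Num.max (- f k) 0.

Let pos_ge0 f k : 0 <= pos f k. Proof. by rewrite le_max lexx orbT. Qed.
Let neg_ge0 f k : 0 <= neg f k. Proof. by rewrite le_max lexx orbT. Qed.

Let posBneg f : f = fun k => pos f k - neg f k.
Proof.
apply/funext => k; rewrite /pos /neg; case/orP: (le_total 0 (f k)) => fk.
  by rewrite max_l// max_r ?oppr_le0// subr0.
by rewrite max_r// max_l ?oppr_ge0// sub0r opprK.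
Qed.

Let pos_summable f : abs_summable f -> abs_summable (pos f).
Proof.
move/abs_summable_norm; apply: abs_summable_le => k.
by rewrite ger0_norm// ge_max ler_norm normr_ge0.
Qed.

Let neg_summable f : abs_summable f -> abs_summable (neg f).
Proof.
move/abs_summable_norm; apply: abs_summable_le => k.
by rewrite ger0_norm// ge_max ler_normr lexx orbT normr_ge0.
Qed.

Let zsumR_posneg f : abs_summable f -> zsumR f = zsumR (pos f) - zsumR (neg f).
Proof.
move=> sf; rewrite {1}(posBneg f) zsumRB_pos//.
- exact: pos_summable.
- exact: neg_summable.
Qed.

Lemma zsumRN f : abs_summable f -> zsumR (fun k => - f k) = - zsumR f.
Proof.
move=> sf; rewrite (zsumR_posneg sf) opprB.
rewrite -zsumRB_pos//; [|exact: neg_summable|exact: pos_summable].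
by congr zsumR; apply/funext => k; rewrite {1}(posBneg f) opprB.
Qed.

Lemma zsumRD f g : abs_summable f -> abs_summable g ->
  zsumR (fun k => f k + g k) = zsumR f + zsumR g.
Proof.
move=> sf sg; rewrite (zsumR_posneg sf) (zsumR_posneg sg).
have [sf1 sf2] := (pos_summable sf, neg_summable sf).
have [sg1 sg2] := (pos_summable sg, neg_summable sg).
rewrite addrACA -opprD -!zsumRD_pos//.
(* [pos f + pos g] and [neg f + neg g] are not the positive and negative parts of [f + g], but they
   are nonnegative with the right difference. *)
rewrite -zsumRB_pos; [|by move=> k; rewrite addr_ge0..| |].
- congr zsumR; apply/funext => k.
  by rewrite [X in X + _ = _](congr1 (@^~ k) (posBneg f))
     [X in _ + X = _](congr1 (@^~ k) (posBneg g)) opprD addrACA.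
- exact: abs_summableD.
- exact: abs_summableD.
Qed.

Lemma zsumRB f g : abs_summable f -> abs_summable g ->
  zsumR (fun k => f k - g k) = zsumR f - zsumR g.
Proof.
by move=> sf sg; rewrite zsumRD ?zsumRN//; exact: abs_summableN.
Qed.

Let zsumRZ_pos c f : 0 <= c -> abs_summable f ->
  zsumR (fun k => c * f k) = c * zsumR f.
Proof.
move=> c0 sf; rewrite (zsumR_posneg sf) mulrBr.
have zZ g : (forall k, 0 <= g k) -> abs_summable g ->
    c * zsumR g = zsumR (fun k => c * g k).
  move=> g0 sg; apply: EFin_inj; rewrite EFinM -!esum_zsumR//.
  + by rewrite -esumZl// => k; rewrite lee_fin.
  + by move=> k; rewrite mulr_ge0.
  + exact: abs_summableZ.
rewrite !zZ//; [|exact: neg_summable|exact: pos_summable].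
rewrite -zsumRB_pos; [|by move=> k; rewrite mulr_ge0..| |].
- by congr zsumR; apply/funext => k; rewrite {1}(posBneg f) mulrBr.
- exact/abs_summableZ/pos_summable.
- exact/abs_summableZ/neg_summable.
Qed.

Lemma zsumRZ c f : abs_summable f -> zsumR (fun k => c * f k) = c * zsumR f.
Proof.
move=> sf; have [c0|c0] := leP 0 c; first exact: zsumRZ_pos.
rewrite -[c in RHS]opprK mulNr -zsumRZ_pos ?oppr_ge0 ?ltW//.
rewrite -zsumRN; last exact: abs_summableZ.
by congr zsumR; apply/funext => k; rewrite mulNr opprK.
Qed.

Lemma zsumR_ge0 f : (forall k, 0 <= f k) -> 0 <= zsumR f.
Proof.
move=> f0; rewrite zsumR_ge0E// fine_ge0// esum_ge0// => k _.
by rewrite lee_fin.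
Qed.

Lemma ler_zsumR f g : abs_summable f -> abs_summable g ->
  (forall k, f k <= g k) -> zsumR f <= zsumR g.
Proof.
move=> sf sg fg; rewrite -subr_ge0 -zsumRB//.
by apply: zsumR_ge0 => k; rewrite subr_ge0.
Qed.

Lemma ler_norm_zsumR f g : (forall k, `|f k| <= g k) -> abs_summable g ->
  `|zsumR f| <= zsumR g.
Proof.
move=> fg sg; have sf := abs_summable_le fg sg.
rewrite ler_norml -zsumRN//; apply/andP; split.
- apply: ler_zsumR => //; first exact: abs_summableN.
  by move=> k; have := fg k; rewrite ler_norml => /andP[].
- by apply: ler_zsumR => // k; have := fg k; rewrite ler_norml => /andP[].
Qed.

Lemma ler_zsumR_term f n : (forall k, 0 <= f k) -> abs_summable f ->
  f n <= zsumR f.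
Proof.
move=> f0 sf; rewrite -lee_fin -esum_zsumR//.
rewrite -[leLHS](@esum_set1 _ _ n (EFin \o f)) ?lee_fin//.
by rewrite esum_mkcond; apply: le_esum => k _; case: ifP; rewrite /= lee_fin.
Qed.

Lemma zsumR_shift f n : zsumR (fun k => f (k + n)) = zsumR f.
Proof.
have bij : set_bij [set: int] [set: int] (fun k => k + n).
  split => //; first by move=> i j _ _ /addIr.
  by move=> k _; exists (k - n) => //; rewrite subrK.
rewrite /zsumR; congr (fine (_ - _)%E); rewrite [RHS](reindex_esum _ _ _ _ bij).
  by apply: eq_esum => k _; rewrite !funeposE.
by apply: eq_esum => k _; rewrite !funenegE.
Qed.

Lemma abs_summable_single n c : abs_summable (fun k => if k == n then c else 0).
Proof.
rewrite abs_summableE.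
rewrite (_ : esum _ _ = \esum_(k in [set n]) `|c|%:E)%E.
  by rewrite esum_set1 ?ltry.
rewrite [RHS]esum_mkcond; apply: eq_esum => k _; case: eqP => [->|kn].
  by rewrite mem_set.
by rewrite memNset ?normr0.
Qed.

Lemma zsumR_single n c : zsumR (fun k => if k == n then c else 0) = c.
Proof.
wlog c0 : c / 0 <= c => [wlog_ge0|].
  have [/wlog_ge0//|c0] := leP 0 c.
  rewrite -[RHS]opprK -(wlog_ge0 (- c)) ?oppr_ge0 ?ltW//.
  rewrite -zsumRN; last exact: abs_summable_single.
  by congr zsumR; apply/funext => k; case: eqP; rewrite ?opprK ?oppr0.
rewrite zsumR_ge0E; last by move=> k; case: eqP.
rewrite (_ : esum _ _ = \esum_(k in [set n]) c%:E)%E.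
  by rewrite esum_set1 ?lee_fin.
rewrite [RHS]esum_mkcond; apply: eq_esum => k _; case: eqP => [->|kn].
  by rewrite mem_set.
by rewrite memNset.
Qed.

End AbsoluteSums.

(** * The real inner product on square-summable sequences, Cauchy-Schwarz and the Schur test *)

Section RealInnerProduct.
Context {R : realType}.
Implicit Types (u v w : int -> R[i]) (z : R[i]).

Lemma cmod_sqr z : cmod z ^+ 2 = complex.Re z ^+ 2 + complex.Im z ^+ 2.
Proof. by case: z => a b; rewrite /cmod /= sqr_sqrtr// addr_ge0// sqr_ge0. Qed.

Lemma cmod_ge0 z : 0 <= cmod z.
Proof. by case: z => a b; exact: sqrtr_ge0. Qed.

Lemma cmodM z z' : cmod (z * z') = cmod z * cmod z'.
Proof. exact: ComplexField.Normc.normcM. Qed.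

Lemma cmod_eq0 z : cmod z = 0 -> z = 0.
Proof. exact: ComplexField.Normc.eq0_normc. Qed.

Lemma cmod_real (a : R) : cmod a%:C = `|a|.
Proof. by rewrite /cmod /= expr0n addr0 sqrtr_sqr. Qed.

Lemma norm_Re_cmod z : `|complex.Re z| <= cmod z.
Proof.
rewrite -(@ler_pXn2r _ 2) ?nnegrE ?cmod_ge0//.
by rewrite cmod_sqr real_normK ?num_real// lerDl sqr_ge0.
Qed.

Lemma norm_Im_cmod z : `|complex.Im z| <= cmod z.
Proof.
rewrite -(@ler_pXn2r _ 2) ?nnegrE ?cmod_ge0//.
by rewrite cmod_sqr real_normK ?num_real// lerDr sqr_ge0.
Qed.

Lemma cmodD_sqr z z' : cmod (z + z') ^+ 2 <= 2 * (cmod z ^+ 2 + cmod z' ^+ 2).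
Proof.
rewrite !cmod_sqr; case: z => a b; case: z' => c d /=.
by have := (sqr_ge0 (a - c), sqr_ge0 (b - d)) => -[]; nra.
Qed.

Lemma ReD z z' : complex.Re (z + z') = complex.Re z + complex.Re z'.
Proof. by case: z z' => [a b] [c d]. Qed.

Lemma ImD z z' : complex.Im (z + z') = complex.Im z + complex.Im z'.
Proof. by case: z z' => [a b] [c d]. Qed.

Lemma ReM z z' : complex.Re (z * z') =
  complex.Re z * complex.Re z' - complex.Im z * complex.Im z'.
Proof. by case: z z' => [a b] [c d]. Qed.

Lemma ImM z z' : complex.Im (z * z') =
  complex.Re z * complex.Im z' + complex.Im z * complex.Re z'.
Proof. by case: z z' => [a b] [c d]. Qed.

Lemma zsumD (f g : int -> R[i]) :
  abs_summable (fun k => cmod (f k)) -> abs_summable (fun k => cmod (g k)) ->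
  zsum (fun k => f k + g k) = zsum f + zsum g.
Proof.
move=> sf sg; rewrite /zsum; apply/eqP; rewrite eq_complex /=.
apply/andP; split; apply/eqP.
- under [in LHS]eq_fun do rewrite ReD.
  by apply: zsumRD; apply: (abs_summable_le (fun k => norm_Re_cmod _)).
- under [in LHS]eq_fun do rewrite ImD.
  by apply: zsumRD; apply: (abs_summable_le (fun k => norm_Im_cmod _)).
Qed.

Lemma zsumZ z (f : int -> R[i]) : abs_summable (fun k => cmod (f k)) ->
  zsum (fun k => z * f k) = z * zsum f.
Proof.
move=> sf; have sr := abs_summable_le (fun k => norm_Re_cmod (f k)) sf.
have si := abs_summable_le (fun k => norm_Im_cmod (f k)) sf.
rewrite /zsum; apply/eqP; rewrite eq_complex ReM ImM /=.
apply/andP; split; apply/eqP.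
- under [in LHS]eq_fun do rewrite ReM.
  by rewrite zsumRB ?zsumRZ//; exact: abs_summableZ.
- under [in LHS]eq_fun do rewrite ImM.
  by rewrite zsumRD ?zsumRZ//; exact: abs_summableZ.
Qed.

(** A weighted arithmetic-geometric bound is linear in [a] and [b], so it survives summation; this
    lemma returns to the product afterwards. The choice [t = x / a] avoids the square root in the
    optimal weight. *)
Lemma sqr_le_of_weighted (x a b : R) : 0 <= x -> 0 <= a -> 0 <= b ->
  (forall t, 0 < t -> x *+ 2 <= t * a + b / t) -> x ^+ 2 <= a * b.
Proof.
rewrite le_eqVlt => /predU1P[<-|x0] a0 b0 tP.
  by rewrite expr0n mulr_ge0.
move: a0; rewrite le_eqVlt => /predU1P[a0|a0].
  (* With [a = 0] this weight gives 2x <= x b / (b + 1) < x, a contradiction. *)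
  have := tP ((b + 1) / x); rewrite -a0 mulr0 add0r invf_div.
  rewrite divr_gt0 ?ltr_wpDl// => /(_ isT).
  rewrite mulrA ler_pdivlMr ?ltr_wpDl//.
  nra.
have := tP (x / a); rewrite divr_gt0// => /(_ isT).
rewrite divfK ?gt_eqF// invf_div mulr2n lerD2l mulrA ler_pdivlMr// expr2.
by rewrite mulrC [b * a]mulrC.
Qed.

(* The real bilinear form suffices: that H is symmetric is recovered from
   [Im <H u, u> = 0] through multiplication by ['i]. *)
Definition rinner u v : R := complex.Re (inner u v).

Lemma rinnerE u v : rinner u v = zsumR (fun n =>
  complex.Re (u n) * complex.Re (v n) + complex.Im (u n) * complex.Im (v n)).
Proof.
rewrite /rinner /inner /zsum /=; congr zsumR; apply/funext => n.
by case: (u n) (v n) => [a b] [c d] /=; ring.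
Qed.

Lemma ell2E u : ell2 u = abs_summable (fun n => cmod (u n) ^+ 2).
Proof.
rewrite /ell2 abs_summableE; congr (_ < _)%E.
by apply: eq_esum => n _; rewrite ger0_norm ?sqr_ge0.
Qed.

Lemma ell2_comb (a : R[i]) u v : ell2 u -> ell2 v ->
  ell2 (fun n => a * u n + v n).
Proof.
rewrite !ell2E => su sv.
have := abs_summableD (abs_summableZ (2 * cmod a ^+ 2) su) (abs_summableZ 2 sv).
apply: abs_summable_le => k; rewrite ger0_norm ?sqr_ge0//.
apply: le_trans (cmodD_sqr _ _) _.
by rewrite cmodM exprMn -mulrA -mulrDr mulrA.
Qed.

Lemma ell20 : ell2 (fun=> 0 : R[i]).
Proof.
rewrite ell2E; apply: abs_summable_le abs_summable0 => k.
by rewrite cmod_sqr /= expr0n/= addr0 normr0.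
Qed.

Lemma ell2Z (a : R[i]) u : ell2 u -> ell2 (fun n => a * u n).
Proof.
move=> su; have := ell2_comb a su ell20.
by congr ell2; apply/funext => n; rewrite addr0.
Qed.

Lemma ell2D u v : ell2 u -> ell2 v -> ell2 (fun n => u n + v n).
Proof.
move=> su sv; have := ell2_comb 1 su sv.
by congr ell2; apply/funext => n; rewrite mul1r.
Qed.

Lemma ell2B u v : ell2 u -> ell2 v -> ell2 (fun n => u n - v n).
Proof.
move=> su sv; have := ell2_comb (-1) sv su.
by congr ell2; apply/funext => n; rewrite mulN1r addrC.
Qed.

(* Optimizing over [t] turns the sum over [n] into Cauchy-Schwarz. *)
Let weighted_young u v n (t : R) : 0 < t ->
  `|complex.Re (u n) * complex.Re (v n) + complex.Im (u n) * complex.Im (v n)|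
    *+ 2 <= t * cmod (u n) ^+ 2 + t^-1 * cmod (v n) ^+ 2.
Proof.
move=> t0; rewrite !cmod_sqr.
case: (u n) (v n) => [a b] [c d] /=.
have tt : t * t^-1 = 1 by rewrite divff ?gt_eqF.
have ti0 : 0 < t^-1 by rewrite invr_gt0.
(* The sign [s] is 1 or -1, so that completing the square bounds the product from both sides. *)
have e x y s : s ^+ 2 = 1 ->
    t * x ^+ 2 + t^-1 * y ^+ 2 - (s * x * y) *+ 2 = t * (x - s * t^-1 * y) ^+ 2.
  move=> s1; rewrite [RHS](_ : _ = t * x ^+ 2 - (t * t^-1) * (s * x * y) *+ 2 +
     (t * t^-1) * s ^+ 2 * t^-1 * y ^+ 2); last by ring.
  by rewrite tt s1; ring.
have f x y s : s ^+ 2 = 1 -> (s * x * y) *+ 2 <= t * x ^+ 2 + t^-1 * y ^+ 2.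
  by move=> /e h; rewrite -subr_ge0 h mulr_ge0 ?sqr_ge0 ?ltW.
have := (f a c 1 (expr1n _ _), f b d 1 (expr1n _ _)).
have := (f a c (-1) (sqrr_sign _ 1), f b d (-1) (sqrr_sign _ 1)).
by case=> h1 h2 [h3 h4]; rewrite -mulr_natr -ler_pdivlMr// ler_norml; lra.
Qed.

Lemma rinner_summable u v : ell2 u -> ell2 v -> abs_summable (fun n =>
  complex.Re (u n) * complex.Re (v n) + complex.Im (u n) * complex.Im (v n)).
Proof.
rewrite !ell2E => su sv; apply: abs_summable_le (abs_summableD su sv) => n.
have := weighted_young u v n ltr01; rewrite invr1 !mul1r; apply: le_trans.
by rewrite mulr2n lerDl.
Qed.

Lemma rinner_comb (a : R) u v w : ell2 u -> ell2 v -> ell2 w ->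
  rinner (fun n => a%:C * u n + v n) w = a * rinner u w + rinner v w.
Proof.
move=> su sv sw; rewrite !rinnerE -zsumRZ; last exact: rinner_summable.
rewrite -zsumRD; [|exact/abs_summableZ/rinner_summable|exact: rinner_summable].
congr zsumR; apply/funext => n.
by case: (u n) (v n) => [x y] [x' y'] /=; ring.
Qed.

Lemma rinnerC u v : rinner u v = rinner v u.
Proof. by rewrite !rinnerE; congr zsumR; apply/funext => n; ring. Qed.

Lemma rinnerDl u v w : ell2 u -> ell2 v -> ell2 w ->
  rinner (fun n => u n + v n) w = rinner u w + rinner v w.
Proof.
move=> su sv sw.
have -> : (fun n => u n + v n) = (fun n => 1%:C * u n + v n).
  by apply/funext => n; rewrite rmorph1 mul1r.
by rewrite rinner_comb// mul1r.
Qed.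

Lemma rinnerBl u v w : ell2 u -> ell2 v -> ell2 w ->
  rinner (fun n => u n - v n) w = rinner u w - rinner v w.
Proof.
move=> su sv sw.
have -> : (fun n => u n - v n) = (fun n => (-1)%:C * v n + u n).
  by apply/funext => n; rewrite rmorphN rmorph1 mulN1r addrC.
by rewrite rinner_comb// mulN1r addrC.
Qed.

Lemma rinnerZl (a : R) u w : ell2 u -> ell2 w ->
  rinner (fun n => a%:C * u n) w = a * rinner u w.
Proof.
move=> su sw; rewrite !rinnerE -zsumRZ; last exact: rinner_summable.
congr zsumR; apply/funext => n.
by case: (u n) => [x y] /=; ring.
Qed.

Lemma rinnerDr u v w : ell2 u -> ell2 v -> ell2 w ->
  rinner w (fun n => u n + v n) = rinner w u + rinner w v.
Proof. by move=> *; rewrite rinnerC rinnerDl// !(rinnerC w). Qed.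

Lemma rinnerBr u v w : ell2 u -> ell2 v -> ell2 w ->
  rinner w (fun n => u n - v n) = rinner w u - rinner w v.
Proof. by move=> *; rewrite rinnerC rinnerBl// !(rinnerC w). Qed.

Lemma rinner0l v : rinner (fun=> 0) v = 0.
Proof.
rewrite rinnerE (_ : (fun n => _) = fun=> 0).
  by rewrite zsumR_ge0E// esum1.
by apply/funext => n; rewrite /= !mul0r addr0.
Qed.

Lemma rinner_ii u v : rinner (fun n => 'i * u n) (fun n => 'i * v n) = rinner u v.
Proof.
rewrite !rinnerE; congr zsumR; apply/funext => n.
by case: (u n) (v n) => [x y] [x' y'] /=; ring.
Qed.

Lemma Im_inner u v : complex.Im (inner u v) = rinner u (fun n => 'i * v n).
Proof.
rewrite rinnerE /inner /zsum /=; congr zsumR; apply/funext => n.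
by case: (u n) (v n) => [a b] [c d] /=; ring.
Qed.

Lemma rinner_sqr u : rinner u u = zsumR (fun n => cmod (u n) ^+ 2).
Proof.
by rewrite rinnerE; congr zsumR; apply/funext => n; rewrite cmod_sqr !expr2.
Qed.

Lemma rinner_ge0 u : 0 <= rinner u u.
Proof. by rewrite rinner_sqr; apply: zsumR_ge0 => n; rewrite sqr_ge0. Qed.

Lemma rinner_eq0 u : ell2 u -> rinner u u = 0 -> u = fun=> 0.
Proof.
rewrite ell2E rinner_sqr => su u0; apply/funext => n.
have := ler_zsumR_term n (fun k => sqr_ge0 (cmod (u k))) su; rewrite u0 => un.
by apply: cmod_eq0; apply/eqP; rewrite -sqrf_eq0 eq_le un sqr_ge0.
Qed.

Lemma rinner_cauchy_schwarz u v : ell2 u -> ell2 v ->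
  rinner u v ^+ 2 <= rinner u u * rinner v v.
Proof.
move=> su sv; rewrite -real_normK ?num_real//.
apply: sqr_le_of_weighted; rewrite ?rinner_ge0// => t t0.
have su' := su; have sv' := sv; move: su' sv'; rewrite !ell2E => su' sv'.
rewrite !rinner_sqr (mulrC _ t^-1) -!zsumRZ//.
rewrite -zsumRD//; [|exact: abs_summableZ..].
rewrite -mulr_natr -ler_pdivlMr// mulrC -zsumRZ; last first.
  by apply: abs_summableD; exact: abs_summableZ.
rewrite rinnerE; apply: ler_norm_zsumR.
  by move=> k; rewrite [leRHS]mulrC ler_pdivlMr// mulr_natr weighted_young.
by apply: abs_summableZ; apply: abs_summableD; exact: abs_summableZ.
Qed.

Lemma rinner_single u n (a : R) :
  rinner u (fun k => if k == n then a%:C else 0) = complex.Re (u n) * a.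
Proof.
rewrite rinnerE -[RHS](zsumR_single n); congr zsumR; apply/funext => k.
by case: eqP => [->|_] /=; rewrite ?mulr0 addr0.
Qed.

Lemma ell2_single n (a : R[i]) : ell2 (fun k => if k == n then a else 0).
Proof.
rewrite ell2E; apply: abs_summable_le (abs_summable_single n (cmod a ^+ 2)) => k.
rewrite ger0_norm ?sqr_ge0//; case: eqP => // _.
by rewrite cmod_sqr /= expr0n addr0.
Qed.

(* The factor 2 comes from treating real and imaginary parts separately. *)
Lemma zsum_schur (F : int -> int -> R[i]) (b : int -> R) (c : int -> int -> R)
    (D : R) :
  (forall k, 0 <= b k) -> (forall n k, 0 <= c n k) -> 0 <= D ->
  abs_summable b ->
  (forall n k, cmod (F n k) ^+ 2 <= b k * c n k) ->
  (forall k, \esum_(n in [set: int]) (c n k)%:E <= (D * b k)%:E)%E ->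
  ell2 (fun n => zsum (F n)) /\
  rinner (fun n => zsum (F n)) (fun n => zsum (F n)) <= 2 * D * zsumR b ^+ 2.
Proof.
move=> b0 c0 D0 sb Fbc cD.
have csum : (\esum_(n in [set: int]) \esum_(k in [set: int]) (c n k)%:E <=
    (D * zsumR b)%:E)%E.
  rewrite esum_exchange; last by move=> *; rewrite lee_fin.
  rewrite EFinM -(esum_zsumR b0 sb) -esumZl//.
  by apply: le_esum => k _; rewrite -EFinM.
have sc n : abs_summable (c n).
  rewrite abs_summableE; under eq_esum do rewrite ger0_norm//.
  apply: le_lt_trans (ltry (D * zsumR b)); apply: le_trans csum.
  pose row n := (\esum_(k in [set: int]) (c n k)%:E)%E.
  rewrite -[leLHS](@esum_set1 _ _ n row).
    rewrite esum_mkcond; apply: le_esum => k _; case: ifP => // _.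
    by apply: esum_ge0 => j _; rewrite lee_fin.
  by apply: esum_ge0 => j _; rewrite lee_fin.
(* The weight [t] is kept free: the bound is first summed over [k], and only then optimized by
   [sqr_le_of_weighted]. *)
have cF n k t : 0 < t -> cmod (F n k) <= 2^-1 * (t * b k + t^-1 * c n k).
  move=> t0; rewrite -(@ler_pXn2r _ 2) ?nnegrE ?cmod_ge0//; last first.
    by rewrite mulr_ge0// addr_ge0// mulr_ge0// ?invr_ge0 ltW.
  apply: le_trans (Fbc n k) _; rewrite -subr_ge0.
  rewrite (_ : _ - _ = (2^-1 * (t * b k - t^-1 * c n k)) ^+ 2) ?sqr_ge0//.
  have tt : t * t^-1 = 1 by rewrite divff ?gt_eqF.
  rewrite -[X in _ - X]mul1r -tt; field.
  by rewrite gt_eqF.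
have schur1 n (f : int -> R) : (forall k, `|f k| <= cmod (F n k)) ->
    zsumR f ^+ 2 <= zsumR b * zsumR (c n).
  move=> fF; rewrite -real_normK ?num_real//.
  apply: sqr_le_of_weighted; rewrite ?zsumR_ge0// => t t0.
  rewrite (mulrC _ t^-1) -!zsumRZ// -zsumRD//; [|exact: abs_summableZ..].
  rewrite -mulr_natr -ler_pdivlMr// mulrC -zsumRZ; last first.
    by apply: abs_summableD; exact: abs_summableZ.
  apply: ler_norm_zsumR => [k|]; first exact: le_trans (fF k) (cF n k t t0).
  by apply: abs_summableZ; apply: abs_summableD; exact: abs_summableZ.
have gn n : cmod (zsum (F n)) ^+ 2 <= 2 * zsumR b * zsumR (c n).
  rewrite cmod_sqr /zsum /= -mulrA mulr_natl mulr2n lerD// schur1// => k.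
    exact: norm_Re_cmod.
  exact: norm_Im_cmod.
have B0 : 0 <= zsumR b by exact: zsumR_ge0.
have main : (\esum_(n in [set: int]) (cmod (zsum (F n)) ^+ 2)%:E <=
    (2 * D * zsumR b ^+ 2)%:E)%E.
  rewrite (_ : 2 * D * _ = 2 * zsumR b * (D * zsumR b)); last by ring.
  rewrite EFinM; apply: le_trans (lee_wpmul2l _ csum); last first.
    by rewrite lee_fin mulr_ge0.
  rewrite -esumZl ?mulr_ge0//; last first.
    by move=> n; apply: esum_ge0 => k _; rewrite lee_fin.
  by apply: le_esum => n _; rewrite esum_zsumR// -EFinM lee_fin.
have l2 : ell2 (fun n => zsum (F n)) by exact: le_lt_trans main (ltry _).
split=> //; rewrite rinner_sqr -lee_fin -esum_zsumR//; last by rewrite -ell2E.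
by move=> k; rewrite sqr_ge0.
Qed.

End RealInnerProduct.

(** * Long-range operators *)

Section LongRangeOperator.
Context {R : realType}.
Implicit Types (u : int -> R[i]) (n k : int).

Lemma nat_inv_sqr_esum :
  (\esum_(i in [set: nat]) ((i%:R ^+ 2)^-1 : R)%:E <= 2%:E)%E.
Proof.
have a0 (i : nat) : (0 <= ((i%:R ^+ 2)^-1 : R)%:E)%E.
  by rewrite lee_fin invr_ge0 sqr_ge0.
rewrite -nneseries_esumT//; apply: lime_le; first exact: is_cvg_nneseries.
apply: nearW => n; rewrite sumEFin lee_fin.
(* Telescoping through 1/x - 1/(x+1) >= 1/(x+1)^2. Since the inverse of 0 is 0, the bound at [m = 0]
   is 2, too weak to start the induction, so [m = 1] is checked separately. *)
suff main m : \sum_(0 <= i < m.+1) ((i%:R ^+ 2)^-1 : R) <= 2 - m%:R^-1.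
  case: n => [|n]; first by rewrite big_geq.
  by apply: le_trans (main n) _; rewrite gerBl invr_ge0.
elim: m => [|[|m] IH].
- by rewrite big_nat1 expr0n invr0 subr0.
- by rewrite big_nat_recr//= big_nat1 expr0n invr0 expr1n invr1; lra.
rewrite big_nat_recr//=; apply: le_trans (lerD IH (lexx _)) _.
rewrite -(natr1 m.+1); set x := m.+1%:R.
have x0 : 0 < x by rewrite ltr0n.
rewrite -subr_ge0 (_ : _ - _ = (x * (x + 1) ^+ 2)^-1).
  by rewrite invr_ge0 mulr_ge0 ?sqr_ge0 ?ltW.
by field; apply/andP; split; rewrite gt_eqF// addr_gt0.
Qed.

Lemma abs_summable_inv_sqr : abs_summable (fun k : int => (`|k|%:~R ^+ 2)^-1 : R).
Proof.
rewrite abs_summableE.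
have E k : `|(`|k|%:~R ^+ 2)^-1 : R| = ((`|k|%N%:R ^+ 2)^-1 : R).
  by rewrite ger0_norm ?invr_ge0 ?sqr_ge0// -abszE -pmulrn.
under eq_esum do rewrite E.
rewrite (esumID (range Posz)); last first.
  by move=> k _; rewrite lee_fin invr_ge0 sqr_ge0.
rewrite !setTI (_ : ~` range Posz = range Negz); last first.
  apply/seteqP; split => [[k|k]|_ [k _ <-]] //=; last by case.
    by case; exists k.
  by exists k.
rewrite !esum_image; [|by move=> i j _ _ []..].
apply: lte_add_pinfty; apply: le_lt_trans (ltry (2 : R)).
  exact: nat_inv_sqr_esum.
apply: le_trans nat_inv_sqr_esum.
(* [Negz k] is -(k+1), so the negative half is the series over the naturals without its term at 0,
   and that term is 0 by the convention on inverses. *)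
rewrite [leRHS](esumID [set 0%N])//.
rewrite setTI esum_set1 ?lee_fin ?invr_ge0 ?sqr_ge0//.
rewrite expr0n invr0 add0e setTI.
rewrite (_ : ~` [set 0%N] = range S); last first.
  apply/seteqP; split => [[|k]|_ [k _ <-]] //=.
  by exists k.
by rewrite esum_image// => i j _ _ [].
Qed.

Variables (w : int -> R[i]) (v : int -> R).
Hypothesis w_decay : exists C : R, forall k : int, k != 0 ->
  cmod (w k) < C / (`|k|%:~R) ^+ 3.
Hypothesis v_bounded : exists B : R, forall n : int, `|v n| <= B.

(** The cubic decay enters here: one factor |k| pays for the variation of the cutoff over a hop of
    length |k|, and a summable |k|^-2 is left. *)
Lemma weighted_hopping_summable :
  abs_summable (fun k => `|k|%:~R * cmod (w k)).
Proof.
have [C wC] := w_decay.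
have := abs_summableZ C abs_summable_inv_sqr.
apply: abs_summable_le => k; rewrite ger0_norm ?mulr_ge0 ?ler0z ?cmod_ge0//.
have [->|k0] := eqVneq k 0; first by rewrite normr0 mul0r expr0n invr0 mulr0.
have kp : 0 < `|k|%:~R :> R by rewrite ltr0z normr_gt0.
rewrite mulrC -ler_pdivlMr//; apply: le_trans (ltW (wC k k0)) _.
by rewrite -mulrA -invfM -exprSr.
Qed.

Lemma hopping_summable : abs_summable (fun k => cmod (w k)).
Proof.
(* The weight |k| erases the term at 0, which the decay does not control either; it is added back by
   hand. *)
have := abs_summableD weighted_hopping_summable
  (abs_summable_single 0 (cmod (w 0))).
apply: abs_summable_le => k; rewrite ger0_norm ?cmod_ge0//.
case: eqP => [->|/eqP k0]; first by rewrite lerDr mulr_ge0// cmod_ge0.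
by rewrite addr0 ler_peMl ?cmod_ge0// ler1z -gtz0_ge1 normr_gt0.
Qed.

Definition bounded_seq u := exists B : R, forall n, cmod (u n) <= B.

Lemma bounded_seq_comb (a : R[i]) u u' : bounded_seq u -> bounded_seq u' ->
  bounded_seq (fun n => a * u n + u' n).
Proof.
move=> [B uB] [B' uB']; exists (cmod a * B + B') => n.
apply: le_trans (le_normcD (a * u n : Rcomplex R) (u' n)) _.
by rewrite -/(cmod _) -/(cmod _) cmodM lerD// ler_wpM2l// cmod_ge0.
Qed.

Lemma ell2_bounded u : ell2 u -> bounded_seq u.
Proof.
rewrite ell2E => su; exists (1 + zsumR (fun n => cmod (u n) ^+ 2)) => n.
have := ler_zsumR_term n (fun k => sqr_ge0 (cmod (u k))) su.
by have := sqr_ge0 (cmod (u n) - 2^-1); nra.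
Qed.

Lemma long_range_summable u n : bounded_seq u ->
  abs_summable (fun k => cmod (w k * u (n + k))).
Proof.
move=> [B uB]; apply: abs_summable_le (abs_summableZ B hopping_summable) => k.
by rewrite ger0_norm ?cmod_ge0// cmodM mulrC ler_wpM2r ?cmod_ge0.
Qed.

Lemma long_range_op_comb (a : R[i]) u u' : bounded_seq u -> bounded_seq u' ->
  long_range_op w v (fun n => a * u n + u' n) =
  (fun n => a * long_range_op w v u n + long_range_op w v u' n).
Proof.
move=> bu bu'; apply/funext => n; rewrite /long_range_op.
have su := long_range_summable n bu; have su' := long_range_summable n bu'.
have sau : abs_summable (fun k => cmod (a * (w k * u (n + k)))).
  by under eq_fun do rewrite cmodM; exact: abs_summableZ.
have -> : zsum (fun k => w k * (a * u (n + k) + u' (n + k))) =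
    a * zsum (fun k => w k * u (n + k)) + zsum (fun k => w k * u' (n + k)).
  rewrite -(zsumZ a su) -(zsumD sau su').
  by congr zsum; apply/funext => k; rewrite mulrDr mulrCA.
by rewrite mulrDr mulrDr addrACA (mulrCA a).
Qed.

Lemma long_range_op_ell2 u : ell2 u -> ell2 (long_range_op w v u).
Proof.
move=> su; apply: ell2D; last first.
  have [B vB] := v_bounded; move: su; rewrite !ell2E => su.
  apply: abs_summable_le (abs_summableZ (B ^+ 2) su) => k.
  rewrite ger0_norm ?sqr_ge0// cmodM exprMn ler_wpM2r ?sqr_ge0//.
  by rewrite cmod_real !expr2 ler_pM.
have su' := su; rewrite ell2E in su'.
(* Young's inequality for the convolution of l^1 with l^2, by splitting |w_k|^2 evenly between the
   two Schur weights. *)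
have [] // := @zsum_schur R (fun n k => w k * u (n + k)) (fun k => cmod (w k))
  (fun n k => cmod (w k) * cmod (u (n + k)) ^+ 2)
  (zsumR (fun n => cmod (u n) ^+ 2)).
- by move=> k; exact: cmod_ge0.
- by move=> n k; rewrite mulr_ge0 ?sqr_ge0 ?cmod_ge0.
- by apply: zsumR_ge0 => n; exact: sqr_ge0.
- exact: hopping_summable.
- by move=> n k; rewrite cmodM exprMn expr2 mulrA.
- move=> k; under eq_esum do rewrite EFinM.
  rewrite esumZl ?cmod_ge0//; last by move=> n; rewrite lee_fin sqr_ge0.
  rewrite mulrC EFinM lee_wpmul2l ?lee_fin ?cmod_ge0//.
  have bij : set_bij [set: int] [set: int] (fun n => n + k).
    split => //; first by move=> i j _ _ /addIr.
    by move=> n _; exists (n - k) => //; rewrite subrK.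
  rewrite -esum_zsumR//; last by move=> n; exact: sqr_ge0.
  by rewrite [leRHS](reindex_esum _ _ _ _ bij).
Qed.

Definition box (L : nat) (n0 n : int) : R := (`|n - n0| < L%:Z)%R%:R.

(** Going from [L] to [L.+1] adds only the two sites n0 + L and n0 - L. They coincide for [L = 0]
    but are counted twice, which costs nothing of importance. *)
Lemma box_sum L n0 : abs_summable (box L n0) /\ zsumR (box L n0) <= L%:R *+ 2.
Proof.
elim: L => [|L [sL IH]].
  have -> : box 0 n0 = fun=> 0 by apply/funext => n; rewrite /box ltNge normr_ge0.
  split; first exact: abs_summable0.
  by rewrite mul0rn zsumR_ge0E// esum1.
pose g n : R := box L n0 n +
  ((if n == n0 + L%:Z then 1 else 0) + (if n == n0 - L%:Z then 1 else 0)).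
have sg1 : abs_summable (fun n =>
    (if n == n0 + L%:Z then 1 else 0) + (if n == n0 - L%:Z then 1 else 0) : R).
  by apply: abs_summableD; exact: abs_summable_single.
have sg : abs_summable g by exact: abs_summableD.
have bg n : box L.+1 n0 n <= g n.
  have e0 (b : bool) : 0 <= (if b then 1 else 0 : R) by case: b.
  rewrite /g /box; case: (ltP `|n - n0| L.+1%:Z) => [h|_]; last first.
    by rewrite !addr_ge0 ?ler0n.
  case: (ltP `|n - n0| L%:Z) => [_|h']; first by rewrite lerDl addr_ge0.
  have [_|n1] := eqVneq n (n0 + L%:Z); first by rewrite add0r lerDl.
  have [_|n2] := eqVneq n (n0 - L%:Z); first by rewrite !add0r.
  by exfalso; lia.
have b0 n : `|box L.+1 n0 n| <= g n by rewrite ger0_norm ?ler0n.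
have sb := abs_summable_le b0 sg; split=> //.
apply: le_trans (ler_zsumR sb sg bg) _.
rewrite zsumRD// zsumRD ?zsumR_single; [|exact: abs_summable_single..].
by rewrite -natr1 mulrnDl lerD.
Qed.

(** The slope 1/L matters: cutting off with [box] instead would only bound the squared residual by
    O(1). *)
Definition tent (L : nat) (n0 n : int) : R :=
  Num.max 0 (1 - `|n - n0|%:~R / L%:R).

Lemma tent_lipschitz L n0 n k : (0 < L)%N ->
  `|tent L n0 (n + k) - tent L n0 n| <= `|k|%:~R / L%:R.
Proof.
move=> L0; have Lp : 0 < L%:R :> R by rewrite ltr0n.
have lip (x y d : R) : x <= y + d -> y <= x + d ->
    `|Num.max 0 (1 - x) - Num.max 0 (1 - y)| <= d.
  move=> xy yx; rewrite ler_norml.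
  by apply/andP; case: (ltP 0 (1 - x)) => ?; case: (ltP 0 (1 - y)) => ?; split; lra.
apply: lip; rewrite -mulrDl ler_pM2r ?invr_gt0// -intrD ler_int.
  by lia.
by lia.
Qed.

Lemma tent_box L n0 n : (0 < L)%N -> 0 <= tent L n0 n <= box L n0 n.
Proof.
move=> L0; have Lp : 0 < L%:R :> R by rewrite ltr0n.
rewrite /tent /box le_max lexx/= ge_max ler0n/=.
case: ltP => nL; first by rewrite gerBl divr_ge0 ?ler0z ?ler0n.
by rewrite subr_le0 ler_pdivlMr// mul1r pmulrn ler_int.
Qed.

Lemma tent_center L n0 : tent L n0 n0 = 1.
Proof. by rewrite /tent subrr normr0 mul0r subr0 max_r. Qed.

(** The Lipschitz bound alone is not summable over [n]. The difference vanishes unless one endpoint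
    of the hop lies in the box, which leaves O(L) sites for each [k]. *)
Lemma tent_diff_sqr L n0 n k : (0 < L)%N ->
  (tent L n0 (n + k) - tent L n0 n) ^+ 2 <=
  (`|k|%:~R / L%:R) ^+ 2 * (box L n0 n + box L n0 (n + k)).
Proof.
move=> L0; have lip := tent_lipschitz n0 n k L0.
have h2 : (tent L n0 (n + k) - tent L n0 n) ^+ 2 <= (`|k|%:~R / L%:R) ^+ 2.
  by rewrite -[leLHS]real_normK ?num_real// !expr2 ler_pM.
have [] := (tent_box n0 n L0, tent_box n0 (n + k) L0).
rewrite /box; case: ltP => [_ _ _|_].
  by apply: le_trans h2 _; rewrite ler_peMr ?sqr_ge0// mulr1n lerDl ler0n.
rewrite -eq_le => /eqP t0; case: ltP => [_ _|_].
  by apply: le_trans h2 _; rewrite ler_peMr ?sqr_ge0// mulr1n lerDr ler0n.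
rewrite -eq_le => /eqP t1; rewrite -t0 -t1 subrr expr0n.
by rewrite addr0 mulr0.
Qed.

(* Truncating a bounded generalized eigenfunction to a box of size L gives a
   vector of squared norm O(L) whose residual has squared norm O(1/L). *)
Lemma truncated_eigenfunction u (E : R) n0 : bounded_seq u ->
  (forall n, long_range_op w v u n = E%:C * u n) ->
  exists2 C : R, 0 <= C & forall L : nat, (0 < L)%N ->
    exists psi, [/\ ell2 psi, psi n0 = u n0, rinner psi psi <= C * L%:R &
      let f := fun n => long_range_op w v psi n - E%:C * psi n in
      rinner f f <= C / L%:R].
Proof.
move=> bu eu; have [B uB] := bu.
pose W := zsumR (fun k => `|k|%:~R * cmod (w k)).
have B2 m : 0 <= B ^+ 2 *+ m by rewrite mulrn_wge0 ?sqr_ge0.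
have BW : 0 <= 2 * (B ^+ 2 *+ 4) * W ^+ 2.
  by apply: mulr_ge0; [exact: mulr_ge0|exact: sqr_ge0].
(* The first summand bounds the norm of [psi], by at most 2L sites of size B^2; the second is the
   Schur bound 2 D W^2 with D = 4 B^2 / L, for the residual. *)
exists (B ^+ 2 *+ 2 + 2 * (B ^+ 2 *+ 4) * W ^+ 2) => [|L L0].
  exact: addr_ge0.
have Lp : 0 < L%:R :> R by rewrite ltr0n.
pose psi n := (tent L n0 n)%:C * u n.
have uB2 n : cmod (u n) ^+ 2 <= B ^+ 2.
  by rewrite !expr2 ler_pM ?cmod_ge0.
have psi_le n : cmod (psi n) ^+ 2 <= B ^+ 2 * box L n0 n.
  rewrite cmodM exprMn cmod_real mulrC ler_pM ?sqr_ge0//.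
  have /andP[t0 tb] := tent_box n0 n L0; rewrite ger0_norm//.
  apply: le_trans (_ : box L n0 n ^+ 2 <= _); first by rewrite !expr2 ler_pM.
  by rewrite /box; case: ltP; rewrite ?expr1n ?expr0n.
have [sbox boxL] := box_sum L n0.
have spsi : ell2 psi.
  rewrite ell2E; apply: abs_summable_le (abs_summableZ (B ^+ 2) sbox) => n.
  by rewrite ger0_norm ?sqr_ge0.
exists psi; split=> //.
- by rewrite /psi tent_center rmorph1 mul1r.
- rewrite rinner_sqr; apply: le_trans (_ : B ^+ 2 * zsumR (box L n0) <= _).
    rewrite -zsumRZ//; apply: ler_zsumR => //; first by rewrite -ell2E.
    exact: abs_summableZ.
  rewrite mulrDl; apply: ler_wpDr.
    by rewrite mulr_ge0// ltW.
  by rewrite mulrnAl -mulrnAr ler_wpM2l ?sqr_ge0.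
move=> f.
(* The potential and [E] commute with the cutoff, so the residual is the commutator of the hopping
   part with [tent], applied to [u]. *)
pose F n k := w k * ((tent L n0 (n + k) - tent L n0 n)%:C * u (n + k)).
have fF : f = fun n => zsum (F n).
  apply/funext => n; rewrite /f /long_range_op.
  have -> : E%:C * psi n = (tent L n0 n)%:C * (E%:C * u n).
    by rewrite /psi mulrCA.
  rewrite -eu /long_range_op mulrDr.
  rewrite -zsumZ; last exact: long_range_summable.
  rewrite (_ : F n = fun k => w k * psi (n + k) +
     - 1 * ((tent L n0 n)%:C * (w k * u (n + k)))); last first.
    by apply/funext => k; rewrite /F /psi rmorphB; ring.
  have s1 : abs_summable (fun k => cmod ((tent L n0 n)%:C * (w k * u (n + k)))).
    rewrite (_ : (fun k => _) =
      fun k => cmod (tent L n0 n)%:C * cmod (w k * u (n + k))).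
      by apply: abs_summableZ; exact: long_range_summable.
    by apply/funext => k; rewrite cmodM.
  rewrite zsumD; last 2 first.
  - by apply: long_range_summable; exact: ell2_bounded.
  - move: s1; congr abs_summable; apply/funext => k.
    by rewrite mulN1r /cmod normcN.
  by rewrite (zsumZ (-1) s1) /psi; ring.
rewrite fF.
(* The weights share |w_k|^2 as |k| |w_k| times |w_k| / |k|. The square of the Lipschitz bound then
   restores |k| |w_k| in the sum over [n]. At [k = 0] both weights are 0, and so is [F n 0]. *)
have [] := @zsum_schur R F (fun k => `|k|%:~R * cmod (w k))
  (fun n k => cmod (w k) / `|k|%:~R * B ^+ 2 *
     (tent L n0 (n + k) - tent L n0 n) ^+ 2) (B ^+ 2 *+ 4 / L%:R).
- by move=> k; rewrite mulr_ge0 ?ler0z ?cmod_ge0.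
- move=> n k; rewrite mulr_ge0 ?sqr_ge0// mulr_ge0 ?sqr_ge0//.
  by rewrite divr_ge0 ?ler0z ?cmod_ge0.
- by rewrite divr_ge0// ltW.
- exact: weighted_hopping_summable.
- move=> n k; have [->|k0] := eqVneq k 0.
    by rewrite /F addr0 subrr mul0r mulr0 cmod_sqr normr0 !mul0r /= expr0n addr0.
  have kp : 0 < `|k|%:~R :> R by rewrite ltr0z normr_gt0.
  rewrite /F !cmodM cmod_real !exprMn real_normK ?num_real//.
  rewrite [leRHS](_ : _ = cmod (w k) ^+ 2 *
    ((tent L n0 (n + k) - tent L n0 n) ^+ 2 * B ^+ 2)); last first.
    by field; rewrite gt_eqF.
  by rewrite ler_wpM2l ?sqr_ge0// ler_wpM2l ?sqr_ge0.
- move=> k; under eq_esum do rewrite EFinM.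
  have c0 : 0 <= cmod (w k) / `|k|%:~R * B ^+ 2.
    by rewrite mulr_ge0 ?sqr_ge0// divr_ge0 ?ler0z ?cmod_ge0.
  rewrite esumZl//; last by move=> n; rewrite lee_fin sqr_ge0.
  pose g n := box L n0 n + box L n0 (n + k).
  have sbox' : abs_summable (fun n => box L n0 (n + k)).
    have [s _] := box_sum L (n0 - k); move: s; congr abs_summable.
    by apply/funext => n; rewrite /box opprB addrA addrAC.
  have sg : abs_summable g by exact: abs_summableD.
  have zg : zsumR g <= L%:R *+ 4.
    by rewrite zsumRD// zsumR_shift (mulrnDr _ 2 2) lerD.
  have g0 n : 0 <= g n by rewrite addr_ge0 ?ler0n.
  apply: le_trans (_ : _ <= (cmod (w k) / `|k|%:~R * B ^+ 2)%:E *
    ((`|k|%:~R / L%:R) ^+ 2 * zsumR g)%:E)%E _.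
    rewrite lee_wpmul2l ?lee_fin// EFinM -(esum_zsumR g0 sg) -esumZl ?sqr_ge0//.
    by apply: le_esum => n _; rewrite -EFinM lee_fin tent_diff_sqr.
  rewrite -EFinM lee_fin.
  have [->|k0] := eqVneq k 0; first by rewrite normr0 invr0 !(mul0r, mulr0).
  have kp : 0 < `|k|%:~R :> R by rewrite ltr0z normr_gt0.
  apply: le_trans (_ : _ <= cmod (w k) / `|k|%:~R * B ^+ 2 *
    ((`|k|%:~R / L%:R) ^+ 2 * (L%:R *+ 4))) _.
    by rewrite ler_wpM2l// ler_wpM2l ?sqr_ge0.
  rewrite le_eqVlt; apply/orP; left; apply/eqP.
  by field; rewrite !gt_eqF.
move=> _ h; apply: le_trans h _.
rewrite [leRHS]mulrDl; apply: ler_wpDl; first by rewrite divr_ge0// ltW.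
by rewrite -/W le_eqVlt; apply/orP; left; apply/eqP; ring.
Qed.

End LongRangeOperator.

(** * Spectral resolutions *)

Section FiniteMeasureMoments.
Context {R : realType}.
Implicit Types (mu nu : {finite_measure set (measurableTypeR R) -> \bar R}).

Lemma second_moment_integrable mu : (\int[mu]_x (x ^+ 2)%:E < +oo)%E ->
  mu.-integrable setT (fun x : R => x%:E).
Proof.
move=> x2; have mT : measurable [set: measurableTypeR R] by [].
have mx2 : measurable_fun [set: R] (EFin \o (fun x : R => x ^+ 2)).
  by apply/measurable_EFinP; exact: measurable_funX.
have i2 : mu.-integrable setT (fun x : R => (x ^+ 2)%:E).
  apply/integrableP; split=> //.
  by under eq_integral do rewrite gee0_abs ?lee_fin ?sqr_ge0//.
have i1 : mu.-integrable setT (EFin \o cst (1 : R)).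
  by apply: finite_measure_integrable_cst.
have := integrableD mT i1 i2.
apply: le_integrable => //; first exact/measurable_EFinP.
move=> x _ /=; rewrite lee_fin (ger0_norm (_ : 0 <= 1 + x ^+ 2)).
  rewrite ler_norml; apply/andP; split.
    by have := sqr_ge0 (x + 2^-1); nra.
  by have := sqr_ge0 (x - 2^-1); nra.
by rewrite addr_ge0 ?sqr_ge0.
Qed.

Lemma Rintegral_conull mu (A : set (measurableTypeR R)) : measurable A ->
  mu (~` A) = 0%E -> mu.-integrable setT (fun x : R => x%:E) ->
  \int[mu]_x x = \int[mu]_(x in A) x.
Proof.
move=> mA A0 ix; have mCA := measurableC mA.
have mid : measurable_fun (~` A) (fun x : R => x%:E).
  by apply: measurable_funTS; exact/measurable_EFinP.
have ixU : mu.-integrable (A `|` ~` A) (fun x : R => x%:E) by rewrite setUv.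
have disj : [disjoint A & ~` A] by apply/disj_setPS; rewrite setICr.
rewrite -(setUv A) (Rintegral_setU mA mCA ixU disj).
by rewrite [X in _ + X]/Rintegral (null_set_integral mCA mid A0) addr0.
Qed.

Lemma measure_conull mu (A : set (measurableTypeR R)) : measurable A ->
  mu (~` A) = 0%E -> mu A = mu setT.
Proof.
move=> mA A0; rewrite -(setUv A) measureU//.
- by rewrite [X in (_ + X)%E]A0 adde0.
- exact: measurableC.
- exact: setICr.
Qed.

Lemma Rintegral_ge_conull mu (A : set (measurableTypeR R)) (c : R) :
  measurable A -> mu (~` A) = 0%E ->
  mu.-integrable setT (fun x : R => x%:E) -> (forall x, A x -> c <= x) ->
  c * fine (mu setT) <= \int[mu]_x x.
Proof.
move=> mA A0 ix cA; rewrite (Rintegral_conull mA A0 ix).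
rewrite -(measure_conull mA A0).
rewrite -Rintegral_cst//; apply: le_Rintegral => //.
- exact: finite_measure_integrable_cst.
- exact: integrableS ix.
Qed.

Lemma Rintegral_le_conull mu (A : set (measurableTypeR R)) (c : R) :
  measurable A -> mu (~` A) = 0%E ->
  mu.-integrable setT (fun x : R => x%:E) -> (forall x, A x -> x <= c) ->
  \int[mu]_x x <= c * fine (mu setT).
Proof.
move=> mA A0 ix cA; rewrite (Rintegral_conull mA A0 ix).
rewrite -(measure_conull mA A0).
rewrite -Rintegral_cst//; apply: le_Rintegral => //.
- exact: integrableS ix.
- exact: finite_measure_integrable_cst.
Qed.

Lemma Rintegral_add mu nu nu' :
  (forall A : set (measurableTypeR R), measurable A -> mu A = (nu A + nu' A)%E) ->
  nu.-integrable setT (fun x : R => x%:E) ->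
  nu'.-integrable setT (fun x : R => x%:E) ->
  \int[mu]_x x = \int[nu]_x x + \int[nu']_x x.
Proof.
move=> muE i1 i2; rewrite /Rintegral.
rewrite (eq_measure_integral (measure_add nu nu')); last first.
  by move=> A mA _; exact: etrans (muE A mA) (esym (measure_addE nu nu' A)).
by rewrite integral_measure_add// fineD//; exact: integrable_fin_num.
Qed.

End FiniteMeasureMoments.

Section SpectralGap.
Context {R : realType}.
Variables (P : set R -> (int -> R[i]) -> (int -> R[i])).
Variables (H : (int -> R[i]) -> (int -> R[i])).
Hypothesis HP : spectral_resolution H P.
Hypothesis H_ell2 : forall u, ell2 u -> ell2 (H u).
Hypothesis H_comb : forall (a : R[i]) u v, ell2 u -> ell2 v ->
  H (fun n => a * u n + v n) = (fun n => a * H u n + H v n).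
Implicit Types (A B : set (measurableTypeR R)) (u v : int -> R[i]).
Implicit Types (mu nu : {finite_measure set (measurableTypeR R) -> \bar R}).

Let PVM : projection_valued_measure P := HP.1.

Lemma spectral_fine mu u A : is_spectral_measure P u mu -> measurable A ->
  fine (mu A) = rinner (P A u) u.
Proof. by move=> sp mA; rewrite /rinner sp. Qed.

Lemma spectral_EFin mu u A : is_spectral_measure P u mu -> measurable A ->
  mu A = (rinner (P A u) u)%:E.
Proof.
by move=> sp mA; rewrite -(spectral_fine sp mA) fineK// fin_num_measure.
Qed.

Lemma pvm_rinnerC A u v : measurable A -> ell2 u -> ell2 v ->
  rinner (P A u) v = rinner u (P A v).
Proof. by move=> mA su sv; rewrite /rinner (pvm_selfadjoint PVM). Qed.

Lemma pvmD A u v : measurable A -> ell2 u -> ell2 v ->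
  P A (fun n => u n + v n) = (fun n => P A u n + P A v n).
Proof.
move=> mA su sv; have := pvm_linear PVM 1 mA su sv.
under eq_fun do rewrite mul1r; move=> ->.
by under eq_fun do rewrite mul1r.
Qed.

Lemma pvm_zero A : measurable A -> P A (fun=> 0) = (fun=> 0).
Proof.
move=> mA; have := pvm_linear PVM (-1) mA (@ell20 R) (@ell20 R).
under eq_fun do rewrite mulr0 addr0; move=> ->.
by apply/funext => n; rewrite mulN1r addNr.
Qed.

Lemma pvmZ A (a : R[i]) u : measurable A -> ell2 u ->
  P A (fun n => a * u n) = (fun n => a * P A u n).
Proof.
move=> mA su; have := pvm_linear PVM a mA su (@ell20 R).
under eq_fun do rewrite addr0; move=> ->; rewrite pvm_zero//.
by under eq_fun do rewrite addr0.
Qed.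

Lemma pvm_rinnerI A B u v : measurable A -> measurable B -> ell2 u -> ell2 v ->
  rinner (P A u) (P B v) = rinner (P (B `&` A) u) v.
Proof.
move=> mA mB su sv; rewrite (pvm_setI PVM)//.
by rewrite (pvm_rinnerC mB (pvm_ell2 PVM mA su) sv).
Qed.

Lemma pvm_disjoint A B u v : measurable A -> measurable B -> ell2 u -> ell2 v ->
  A `&` B = set0 -> rinner (P A u) (P B v) = 0.
Proof.
move=> mA mB su sv AB0; rewrite pvm_rinnerI// setIC AB0 (pvm_set0 PVM)//.
exact: rinner0l.
Qed.

Lemma pvm_norm_sqr A u : measurable A -> ell2 u ->
  rinner (P A u) (P A u) = rinner (P A u) u.
Proof. by move=> mA su; rewrite pvm_rinnerI// setIid. Qed.

(** Countable additivity is given only for the quadratic forms <P(A) u, u>. It passes to vectors by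
    expanding the squared norm of the defect, whose terms cancel. *)
Lemma pvmU A B u : measurable A -> measurable B -> ell2 u -> A `&` B = set0 ->
  P (A `|` B) u = (fun n => P A u n + P B u n).
Proof.
move=> mA mB su AB0.
have mU : measurable (A `|` B) by exact: measurableU.
have [mu sp] := pvm_measure PVM su.
have [sA sB sU] : [/\ ell2 (P A u), ell2 (P B u) & ell2 (P (A `|` B) u)].
  by split; exact: (pvm_ell2 PVM).
have sAB := ell2D sA sB.
have sd := ell2B sU sAB.
suff : (fun n => P (A `|` B) u n - (P A u n + P B u n)) = fun=> 0.
  move=> d0; apply/funext => n; apply/eqP.
  by rewrite -subr_eq0 (congr1 (@^~ n) d0).
apply: (rinner_eq0 sd).
have eA : A `&` (A `|` B) = A by apply/setIidPl; exact: subsetUl.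
have eB : B `&` (A `|` B) = B by apply/setIidPl; exact: subsetUr.
have muU : rinner (P (A `|` B) u) u = rinner (P A u) u + rinner (P B u) u.
  by rewrite -!(spectral_fine sp)// measureU// fineD//; exact: fin_num_measure.
rewrite rinnerBl// !rinnerBr// !rinnerDl// !rinnerDr// !pvm_rinnerI//.
rewrite !(setIC (A `|` B)) eA eB setIid (setIC B A) AB0 !setIid.
by rewrite (pvm_set0 PVM)// rinner0l muU; ring.
Qed.

Lemma pvmC A u : measurable A -> ell2 u ->
  u = (fun n => P A u n + P (~` A) u n).
Proof.
move=> mA su; rewrite -pvmU ?setUv ?(pvm_setT PVM)//; first exact: measurableC.
exact: setICr.
Qed.

Lemma quadratic_form_moment u mu : ell2 u -> is_spectral_measure P u mu ->
  mu.-integrable setT (fun x : R => x%:E) /\ rinner (H u) u = \int[mu]_x x.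
Proof.
move=> su sp; have [x2 hu] := HP.2 u mu su sp.
by split; [exact: second_moment_integrable|rewrite /rinner hu].
Qed.

Lemma quadratic_form_real u : ell2 u -> rinner (H u) (fun n => 'i * u n) = 0.
Proof.
move=> su; have [mu sp] := pvm_measure PVM su.
by have [_ hu] := HP.2 u mu su sp; rewrite -Im_inner hu.
Qed.

Lemma operatorD u v : ell2 u -> ell2 v ->
  H (fun n => u n + v n) = (fun n => H u n + H v n).
Proof.
move=> su sv; have := H_comb 1 su sv.
by under eq_fun do rewrite mul1r; move=> ->; under eq_fun do rewrite mul1r.
Qed.

Lemma operatorZ (a : R[i]) u : ell2 u -> H (fun n => a * u n) = (fun n => a * H u n).
Proof.
move=> su; have H0 : H (fun=> 0) = fun=> 0.
  have := H_comb (-1) (@ell20 R) (@ell20 R).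
  under eq_fun do rewrite mulr0 addr0; move=> ->.
  by apply/funext => n; rewrite mulN1r addNr.
have := H_comb a su (@ell20 R); rewrite H0.
by under eq_fun do rewrite addr0; move=> ->; under eq_fun do rewrite addr0.
Qed.

(* The spectral measures of the two orthogonal components add up, hence so do
   the values of the quadratic form; the cross terms must cancel. *)
Let cross_sum A u v : measurable A -> ell2 u -> ell2 v ->
  rinner (H (P A u)) (P (~` A) v) + rinner (H (P (~` A) v)) (P A u) = 0.
Proof.
move=> mA su sv; have mCA := measurableC mA.
have sa : ell2 (P A u) := pvm_ell2 PVM mA su.
have sb : ell2 (P (~` A) v) := pvm_ell2 PVM mCA sv.
have sab := ell2D sa sb.
have [[[mu1 sp1] [mu2 sp2]] [mu sp]] :=
  (pvm_measure PVM sa, pvm_measure PVM sb, pvm_measure PVM sab).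
have [i1 q1] := quadratic_form_moment sa sp1.
have [i2 q2] := quadratic_form_moment sb sp2.
have [_ q] := quadratic_form_moment sab sp.
have muE C : measurable C -> mu C = (mu1 C + mu2 C)%E.
  move=> mC; rewrite (spectral_EFin sp)// (spectral_EFin sp1)//.
  rewrite (spectral_EFin sp2)// -EFinD pvmD//.
  have [sCa sCb] : ell2 (P C (P A u)) /\ ell2 (P C (P (~` A) v)).
    by split; exact: (pvm_ell2 PVM).
  have cross : rinner (P C (P A u)) (P (~` A) v) = 0.
    rewrite -(pvm_setI PVM)// pvm_disjoint//; first exact: measurableI.
    by rewrite -setIA setICr setI0.
  have cross' : rinner (P C (P (~` A) v)) (P A u) = 0.
    by rewrite pvm_rinnerC// rinnerC.
  by rewrite rinnerDl// !rinnerDr// cross cross' addr0 add0r.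
have := q; rewrite (Rintegral_add muE i1 i2) -q1 -q2 operatorD//.
have [hA hB] := (H_ell2 sa, H_ell2 sb).
by rewrite rinnerDl// !rinnerDr//; lra.
Qed.

(** A weak form of the commutation of [H] with [P A]. [cross_sum] says that the two cross terms are
    opposite. Reality of the quadratic form, tested with 'i v in place of [v], says that they are
    equal. Hence both vanish. *)
Lemma pvm_reduces A u v : measurable A -> ell2 u -> ell2 v ->
  rinner (H (P A u)) (P (~` A) v) = 0.
Proof.
move=> mA su sv; have mCA := measurableC mA.
have sa : ell2 (P A u) := pvm_ell2 PVM mA su.
have sb : ell2 (P (~` A) v) := pvm_ell2 PVM mCA sv.
have [hA hB] := (H_ell2 sa, H_ell2 sb).
have [sia sib] := (ell2Z 'i sa, ell2Z 'i sb).
have siv : ell2 (fun n => 'i * v n) by exact: ell2Z.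
have im w : ell2 w -> rinner (H (P A u)) (fun n => 'i * P (~` A) w n) +
    rinner (H (P (~` A) w)) (fun n => 'i * P A u n) = 0.
  move=> sw; have sc : ell2 (P (~` A) w) := pvm_ell2 PVM mCA sw.
  have hC := H_ell2 sc.
  have := quadratic_form_real (ell2D sa sc); rewrite operatorD//.
  under [X in rinner _ X]eq_fun do rewrite mulrDr.
  rewrite rinnerDl//; [|by apply: ell2D; exact: ell2Z].
  rewrite !rinnerDr//; [|exact: ell2Z..].
  by rewrite !quadratic_form_real// add0r addr0.
have := im _ siv; rewrite pvmZ// operatorZ//.
have -> : (fun n => 'i * ('i * P (~` A) v n)) = (fun n => (-1)%:C * P (~` A) v n).
  by apply/funext => n; rewrite mulrA -expr2 sqr_i rmorphN rmorph1.
rewrite rinner_ii (rinnerC (H (P A u))) rinnerZl// mulN1r (rinnerC _ (H _)).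
by have := cross_sum mA su sv; lra.
Qed.

(** On a set on one side of [E], x - E has constant sign and modulus at least [r], so the first
    moment gives |<f, P(A) psi>| >= r |P(A) psi|^2 for the residual f. Cauchy-Schwarz and division
    by |P(A) psi|^2 finish. *)
Lemma spectral_gap A psi (E r : R) : measurable A -> ell2 psi -> 0 < r ->
  (forall x, A x -> E + r <= x) \/ (forall x, A x -> x <= E - r) ->
  r ^+ 2 * rinner (P A psi) (P A psi) <=
    rinner (fun n => H psi n - E%:C * psi n) (fun n => H psi n - E%:C * psi n).
Proof.
move=> mA spsi r0 gapA; set f := fun n => H psi n - E%:C * psi n.
have mCA := measurableC mA.
have sa : ell2 (P A psi) := pvm_ell2 PVM mA spsi.
have sb : ell2 (P (~` A) psi) := pvm_ell2 PVM mCA spsi.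
have [hA hB] := (H_ell2 sa, H_ell2 sb).
have sE : ell2 (fun n => E%:C * psi n) by exact: ell2Z.
have sf : ell2 f by apply: ell2B => //; exact: H_ell2.
have [mu sp] := pvm_measure PVM sa.
have [ix q] := quadratic_form_moment sa sp.
have mu0 : mu (~` A) = 0%E.
  rewrite (spectral_EFin sp)// -(pvm_setI PVM)// setICl (pvm_set0 PVM)//.
  by rewrite rinner0l.
have muT : fine (mu setT) = rinner (P A psi) (P A psi).
  by rewrite (spectral_fine sp)// (pvm_setT PVM).
have Hpsi : H psi = fun n => H (P A psi) n + H (P (~` A) psi) n.
  by rewrite {1}(pvmC mA spsi) operatorD.
have fa : rinner f (P A psi) = \int[mu]_x x - E * fine (mu setT).
  rewrite rinnerBl//; last exact: H_ell2.
  rewrite rinnerZl// muT -q Hpsi rinnerDl//.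
  have -> : rinner (H (P (~` A) psi)) (P A psi) = 0.
    by have := pvm_reduces mCA spsi spsi; rewrite setCK.
  by rewrite addr0 pvm_norm_sqr// (rinnerC psi).
have N0 := rinner_ge0 (P A psi).
have F0 := rinner_ge0 f.
have fa_ge : (r * rinner (P A psi) (P A psi)) ^+ 2 <= rinner f (P A psi) ^+ 2.
  rewrite -[leRHS]real_normK ?num_real// ler_pXn2r ?nnegrE ?normr_ge0//;
    last by rewrite mulr_ge0// ltW.
  rewrite fa; case: gapA => gapA.
    have := Rintegral_ge_conull mA mu0 ix gapA; rewrite muT => h.
    by apply: le_trans _ (ler_norm _); lra.
  have := Rintegral_le_conull mA mu0 ix gapA; rewrite muT => h.
  by rewrite -normrN; apply: le_trans _ (ler_norm _); lra.
have cs := rinner_cauchy_schwarz sf sa.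
move: N0; rewrite le_eqVlt => /predU1P[<-|N0]; first by rewrite mulr0.
rewrite -(ler_pM2r N0); apply: le_trans cs; apply: le_trans fa_ge.
by rewrite exprMn expr2 -!mulrA.
Qed.

End SpectralGap.

(** * Dyadic decomposition around an energy of zero density *)

Definition zero_density (R : realType)
    (mu : {finite_measure set (measurableTypeR R) -> \bar R}) (E : R) :=
  forall d : R, 0 < d -> exists2 r0 : R, 0 < r0 &
    forall r : R, 0 < r -> r <= r0 ->
      fine (mu `]E - r, E + r[%classic) <= d * r.

Section DyadicEstimate.
Context {R : realType}.
Variables (P : set R -> (int -> R[i]) -> (int -> R[i])).
Variables (H : (int -> R[i]) -> (int -> R[i])).
Hypothesis HP : spectral_resolution H P.
Hypothesis H_ell2 : forall u, ell2 u -> ell2 (H u).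
Hypothesis H_comb : forall (a : R[i]) u v, ell2 u -> ell2 v ->
  H (fun n => a * u n + v n) = (fun n => a * H u n + H v n).

Let PVM : projection_valued_measure P := HP.1.

Let annulus_split (E r : R) (right left : set (measurableTypeR R)) psi phi :
  0 < r -> measurable right -> measurable left -> ell2 psi -> ell2 phi ->
  (forall x, right x -> E + r <= x) -> (forall x, left x -> x <= E - r) ->
  rinner (P ((`]E - r, E + r[ `|` right) `|` left) psi) phi =
  rinner (P `]E - r, E + r[ psi) phi + rinner (P right psi) phi +
  rinner (P left psi) phi.
Proof.
move=> r0 mr ml spsi sphi rE lE.
have mK : measurable (`]E - r, E + r[ : set (measurableTypeR R)).
  exact: measurable_itv.
have d1 : `]E - r, E + r[ `&` right = set0.
  by apply/seteqP; split => x //= -[]; rewrite in_itv/= => /andP[_ h] /rE; lra.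
have d2 : (`]E - r, E + r[ `|` right) `&` left = set0.
  apply/seteqP; split => x //= -[[]].
    by rewrite in_itv/= => /andP[h _] /lE; lra.
  by move=> /rE h /lE; lra.
have sP A : measurable A -> ell2 (P A psi) by move=> mA; exact: (pvm_ell2 PVM).
have mKr : measurable (`]E - r, E + r[ `|` right) by exact: measurableU.
rewrite (pvmU HP mKr ml spsi d2) (pvmU HP mK mr spsi d1).
by rewrite !rinnerDl//; [exact: sP..|apply: ell2D; exact: sP|exact: sP].
Qed.

(** Projecting both vectors to [A] before Cauchy-Schwarz makes the gap act on [psi], while [phi]
    enters only through its spectral mass in [A]. *)
Let piece_bound (A : set (measurableTypeR R)) psi phi (E r F m : R) :
  measurable A -> ell2 psi -> ell2 phi -> 0 < r ->
  (forall x, A x -> E + r <= x) \/ (forall x, A x -> x <= E - r) ->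
  rinner (fun n => H psi n - E%:C * psi n) (fun n => H psi n - E%:C * psi n)
    <= F ->
  rinner (P A phi) phi <= m ->
  (r * rinner (P A psi) phi) ^+ 2 <= F * m.
Proof.
move=> mA spsi sphi r0 gapA fF phim.
have [sA sA'] : ell2 (P A psi) /\ ell2 (P A phi).
  by split; exact: (pvm_ell2 PVM).
have -> : rinner (P A psi) phi = rinner (P A psi) (P A phi).
  by rewrite (pvm_rinnerI HP)// setIid.
have cs := rinner_cauchy_schwarz sA sA'.
have gap := spectral_gap HP H_ell2 H_comb mA spsi r0 gapA.
rewrite (pvm_norm_sqr HP mA sphi) in cs.
rewrite exprMn; apply: le_trans (ler_wpM2l (sqr_ge0 r) cs) _.
rewrite mulrA; apply: ler_pM => //; last exact: le_trans gap fF.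
- by apply: mulr_ge0; [exact: sqr_ge0|exact: rinner_ge0].
- by rewrite -(pvm_norm_sqr HP mA sphi); exact: rinner_ge0.
Qed.

(* Split psi over |x - E| < 1/L, the annuli 4^j/L <= |x - E| < 4^(j+1)/L for
   j < J, and |x - E| >= 1/k, where L = 4^J k and 1/k is a radius below which
   the density of mu is at most d. By the spectral gap the j-th annulus
   contributes O(2^-j sqrt d), and the outer part vanishes as J grows. *)
Lemma zero_density_orthogonal phi mu (E C x : R) :
  ell2 phi -> is_spectral_measure P phi mu -> 0 <= C ->
  zero_density mu E ->
  (forall L : nat, (0 < L)%N -> exists psi, [/\ ell2 psi, rinner psi phi = x,
     rinner psi psi <= C * L%:R &
     rinner (fun n => H psi n - E%:C * psi n) (fun n => H psi n - E%:C * psi n)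
       <= C / L%:R]) ->
  x = 0.
Proof.
move=> sphi sp C0 dens approx.
(* The window and the annuli together cost at most 9s, the outer part at most s. *)
suff small s : 0 < s -> `|x| <= 10 * s.
  apply/eqP; rewrite -normr_le0; apply/ler_addgt0Pr => e e0; rewrite add0r.
  by have := small (e / 10) ltac:(by rewrite divr_gt0); rewrite mulrC divfK.
move=> s0; have [r0 r0p densr] : exists2 r0 : R, 0 < r0 &
    forall r : R, 0 < r -> r <= r0 ->
      C * fine (mu `]E - r, E + r[%classic) <= s ^+ 2 * r.
  (* Adding 1 covers the case [C = 0]. *)
  have d0 : 0 < s ^+ 2 / (C + 1) by rewrite divr_gt0 ?exprn_gt0 ?ltr_wpDl.
  have [r0 r0p h] := dens _ d0; exists r0 => // r rp rr0.
  apply: le_trans (ler_wpM2l C0 (h r rp rr0)) _.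
  rewrite mulrA ler_wpM2r ?(ltW rp)// mulrCA ler_piMr ?sqr_ge0//.
  by rewrite ler_pdivrMr ?ltr_wpDl// mul1r lerDl.
pose k := (Num.truncn r0^-1).+1.
have kp : 0 < k%:R :> R by rewrite ltr0n.
have kr0 : k%:R^-1 <= r0.
  by rewrite -[leRHS]invrK lef_pV2 ?posrE ?invr_gt0// ltW// truncnS_gt.
(* A substitute for a square root: y <= (y + 1)^2 for y >= 0. *)
pose K := k%:R * C * fine (mu setT) + 1.
have mT0 : 0 <= fine (mu setT) by rewrite fine_ge0.
have KP : k%:R * C * fine (mu setT) <= K ^+ 2.
  have : 0 <= k%:R * C * fine (mu setT) by rewrite !mulr_ge0// ltW.
  rewrite /K; set y := _ * fine _; nra.
have K0 : 0 <= K by rewrite addr_ge0// !mulr_ge0// ltW.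
pose J := Num.truncn (2 * K / s).
have JP : 2 * K / 2 ^+ J <= s.
  rewrite ler_pdivrMr ?exprn_gt0// [leRHS]mulrC -ler_pdivrMr//.
  apply: le_trans (ltW (truncnS_gt _)) _; rewrite -/J.
  rewrite (_ : 2 ^+ J = (2 ^ J)%N%:R); last by rewrite natrX.
  rewrite ler_nat.
  exact: ltn_expl.
pose L := (4 ^ J * k)%N.
have L0 : (0 < L)%N by rewrite muln_gt0 expn_gt0.
have Lp : 0 < L%:R :> R by rewrite ltr0n.
have [psi [spsi <- psiL fL]] := approx L L0.
have mmeas (A : set (measurableTypeR R)) : measurable A ->
    rinner (P A phi) phi = fine (mu A).
  by move=> mA; rewrite (spectral_fine sp).
have mono (A B : set (measurableTypeR R)) : measurable A -> measurable B ->
    A `<=` B -> rinner (P A phi) phi <= fine (mu B).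
  move=> mA mB AB; rewrite mmeas// fine_le ?fin_num_measure//.
  by rewrite le_measure ?inE.
pose r j : R := 4 ^+ j / L%:R.
have rp j : 0 < r j by rewrite divr_gt0 ?exprn_gt0.
pose T j := rinner (P `]E - r j, E + r j[ psi) phi.
have rJ : r J = k%:R^-1.
  rewrite /r /L natrM natrX; field.
  by rewrite gt_eqF ?expf_neq0.
have rS j : r j.+1 = 4 * r j by rewrite /r exprS mulrA.
have four j : 4 ^+ j = (2 ^+ j) ^+ 2 :> R.
  by rewrite -exprM mulnC exprM; congr (_ ^+ _); ring.
have two j : 0 < 2 ^+ j :> R by rewrite exprn_gt0.
have mK t : measurable (`]E - t, E + t[%classic : set (measurableTypeR R)).
  exact: measurable_itv.
have T0 : `|T 0%N| <= s.
  rewrite -(@ler_pXn2r _ 2) ?nnegrE ?(ltW s0)// real_normK ?num_real//.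
  have sA : ell2 (P `]E - r 0%N, E + r 0%N[%classic phi).
    exact: (pvm_ell2 PVM (mK _) sphi).
  rewrite /T (pvm_rinnerC HP (mK _) spsi sphi).
  apply: le_trans (rinner_cauchy_schwarz spsi sA) _.
  rewrite (pvm_norm_sqr HP (mK _) sphi) (mmeas _ (mK _)).
  apply: le_trans (ler_wpM2r _ psiL) _; first by rewrite fine_ge0.
  rewrite mulrAC -ler_pdivlMr//; apply: le_trans (densr _ (rp 0%N) _) _.
    apply: le_trans kr0; rewrite -rJ /r ler_pM2r ?invr_gt0// expr0.
    by rewrite exprn_ege1// ler1n.
  by rewrite /r expr0 mul1r.
(* The central window gives s = s (9 - 8). Each further annulus has two halves of size at most 2s /
   2^j, and their sum 4s / 2^j is exactly the increment from j to j+1. *)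
have step j : (j <= J)%N -> `|T j| <= s * (9 - 8 / 2 ^+ j).
  elim: j => [_|j IH jJ]; first by rewrite expr0 divr1; lra.
  have rjr0 : r j.+1 <= r0.
    apply: le_trans kr0; rewrite -rJ /r ler_pM2r ?invr_gt0//.
    by rewrite ler_weXn2l// ler1n.
  pose A1 : set (measurableTypeR R) := `[E + r j, E + r j.+1[%classic.
  pose A2 : set (measurableTypeR R) := `]E - r j.+1, E - r j]%classic.
  have [mA1 mA2] : measurable A1 /\ measurable A2.
    by split; exact: measurable_itv.
  have h1 x' : A1 x' -> E + r j <= x' by rewrite /A1 /= in_itv/= => /andP[].
  have h2 x' : A2 x' -> x' <= E - r j by rewrite /A2 /= in_itv/= => /andP[].
  have rlt : r j < r j.+1 by rewrite rS; have := rp j; lra.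
  have split : `]E - r j.+1, E + r j.+1[%classic =
      (`]E - r j, E + r j[ `|` A1) `|` A2.
    apply/seteqP; split => y; rewrite /A1 /A2 /= !in_itv/=.
      move=> /andP[h3 h4]; case: (leP (E + r j) y) => h5.
        by left; right.
      case: (leP y (E - r j)) => h6; last by left; left.
      by right; rewrite h3.
    by move=> [[]|] /andP[h3 h4]; apply/andP; split; have := rp j; lra.
  (* The mass of the half-annulus is bounded by that of the whole window of radius 4 r_j, so the
     square is at most 4 s^2 / (L r_j) = (2s / 2^j)^2. *)
  have bound A : measurable A -> A `<=` `]E - r j.+1, E + r j.+1[%classic ->
      (forall x, A x -> E + r j <= x) \/ (forall x, A x -> x <= E - r j) ->
      `|rinner (P A psi) phi| <= 2 * s / 2 ^+ j.
    move=> mA AK gapA.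
    have h := piece_bound mA spsi sphi (rp j) gapA fL (mono _ _ mA (mK _) AK).
    have h' : C / L%:R * fine (mu `]E - r j.+1, E + r j.+1[%classic) <=
        s ^+ 2 * r j.+1 / L%:R.
      rewrite mulrAC ler_wpM2r ?invr_ge0 ?(ltW Lp)//.
      exact: densr (rp j.+1) rjr0.
    rewrite -(@ler_pXn2r _ 2) ?nnegrE// ?divr_ge0 ?mulr_ge0 ?(ltW s0) ?(ltW (two j))//.
    rewrite real_normK ?num_real// -(ler_pM2l (exprn_gt0 2 (rp j))) -exprMn.
    apply: le_trans h (le_trans h' _); rewrite rS /r four.
    rewrite le_eqVlt; apply/orP; left; apply/eqP; field.
    by rewrite !gt_eqF.
  rewrite /T split annulus_split//.
  have b1 := bound A1 mA1 _ (or_introl h1).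
  have b2 := bound A2 mA2 _ (or_intror h2).
  rewrite -addrA; apply: le_trans (ler_normD _ _) _.
  apply: le_trans (lerD (IH (ltnW jJ)) (ler_normD _ _)) _.
  apply: le_trans (lerD (lexx _) (lerD (b1 _) (b2 _))) _.
  - by rewrite split => y yA; left; right.
  - by rewrite split => y yA; right.
  rewrite le_eqVlt; apply/orP; left; apply/eqP; rewrite exprS; field.
  by rewrite gt_eqF.
pose B1 : set (measurableTypeR R) := `[E + r J, +oo[%classic.
pose B2 : set (measurableTypeR R) := `]-oo, E - r J]%classic.
have [mB1 mB2] : measurable B1 /\ measurable B2 by split; exact: measurable_itv.
have h1 x' : B1 x' -> E + r J <= x' by rewrite /B1 /= in_itv/= andbT.
have h2 x' : B2 x' -> x' <= E - r J by rewrite /B2 /= in_itv.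
have split : setT = (`]E - r J, E + r J[ `|` B1) `|` B2.
  apply/seteqP; split => y // _; rewrite /B1 /B2 /= !in_itv/= andbT.
  case: (leP (E + r J) y) => h5; first by left; right.
  by case: (leP y (E - r J)) => h6; [right|left; left].
(* Here r_J = 1/k is independent of J. With the total mass of [mu] and L = 4^J k, the square is at
   most k C mu(R) / 4^J. *)
have bound A : measurable A ->
    (forall x, A x -> E + r J <= x) \/ (forall x, A x -> x <= E - r J) ->
    `|rinner (P A psi) phi| <= K / 2 ^+ J.
  move=> mA gapA.
  have h := piece_bound mA spsi sphi (rp J) gapA fL
    (mono _ _ mA measurableT (@subsetT _ A)).
  rewrite -(@ler_pXn2r _ 2) ?nnegrE// ?divr_ge0 ?(ltW (two J))//.
  rewrite real_normK ?num_real// -(ler_pM2l (exprn_gt0 2 (rp J))) -exprMn.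
  apply: le_trans h _; rewrite rJ /L natrM natrX four expr_div_n.
  rewrite [leLHS](_ : _ = (k%:R * C * fine (mu setT)) *
    (k%:R ^- 2 / (2 ^+ J) ^+ 2)); last by field; rewrite !gt_eqF.
  rewrite [leRHS](_ : _ = K ^+ 2 * (k%:R ^- 2 / (2 ^+ J) ^+ 2)); last first.
    by field; rewrite !gt_eqF.
  by rewrite ler_wpM2r// divr_ge0 ?invr_ge0 ?sqr_ge0.
rewrite -(pvm_setT PVM spsi) split annulus_split//.
have b1 := bound B1 mB1 (or_introl h1).
have b2 := bound B2 mB2 (or_intror h2).
have bJ := step J (leqnn _).
rewrite -addrA; apply: le_trans (ler_normD _ _) _.
apply: le_trans (lerD bJ (ler_normD _ _)) _.
apply: le_trans (lerD (lexx _) (lerD b1 b2)) _.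
have : 0 <= 8 / 2 ^+ J * s by rewrite mulr_ge0 ?divr_ge0 ?(ltW (two J)) ?ltW.
by move: JP; rewrite -mulrA; lra.
Qed.

End DyadicEstimate.

(** * Differentiation of finite measures *)

Section ZeroDensity.
Context {R : realType}.
Implicit Types (mu : {finite_measure set (measurableTypeR R) -> \bar R}).

Lemma finite_measure_decreasing mu (A : (set (measurableTypeR R))^nat) (e : R) :
  (forall n, measurable (A n)) -> nonincreasing_seq A -> \bigcap_n A n = set0 ->
  0 < e -> exists n, (mu (A n) <= e%:E)%E.
Proof.
move=> mA niA A0 e0.
have cv : mu (A n) @[n --> \oo] --> 0%E.
  rewrite -(measure0 mu) -A0; apply: nonincreasing_cvg_mu => //.
  - by rewrite -ge0_fin_numE// fin_num_measure.
  - by rewrite A0.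
have /fine_cvgP[_ /cvgrPdist_lt/(_ _ e0)[n _ /(_ n (leqnn n))]] := cv.
rewrite /= sub0r normrN ger0_norm ?fine_ge0// => /ltW h; exists n.
by rewrite -[leLHS]fineK ?fin_num_measure// lee_fin.
Qed.

(** The sets with this approximation property form a sigma-algebra containing the open rays. Asking
    for inner and outer approximation at once makes the property stable under complement. *)
Lemma finite_measure_regular mu (A : set (measurableTypeR R)) (e : R) :
  measurable A -> 0 < e ->
  exists U F : set R,
    [/\ open U, closed F, F `<=` A, A `<=` U & (mu (U `\` F) <= e%:E)%E].
Proof.
pose K (B : set R) := forall e : R, 0 < e -> exists U F : set R,
  [/\ open U, closed F, F `<=` B, B `<=` U & (mu (U `\` F) <= e%:E)%E].
suff sub : (@measurable _ (measurableTypeR R) : set (set R)) `<=` K.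
  by move=> /sub; apply.
rewrite [X in X `<=` _](RGenOInfty.measurableE R); apply: smallest_sub.
- split=> [d d0|B KB d d0|B KB d d0].
  + exists set0, set0; split; [exact: open0|exact: closed0|by []|by []|].
    by rewrite setD0 measure0 lee_fin ltW.
  + have [U [F [oU cF FB BU m]]] := KB d d0; exists (~` F), (~` U); split.
    * exact: closed_openC.
    * exact: open_closedC.
    * by rewrite setTD; exact: subsetC.
    * by rewrite setTD; exact: subsetC.
    * by rewrite setDE setCK setIC -setDE.
  + have d2 k : 0 < d / 2 / (2 ^ k.+1)%:R.
      by rewrite !divr_gt0// ltr0n expn_gt0.
    have /choice[U /choice[F UF]] k := KB k _ (d2 k).
    have oU k : open (U k) by have [] := UF k.
    have cF k : closed (F k) by have [] := UF k.
    have mU k : measurable (U k : set (measurableTypeR R)) by exact: open_measurable.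
    have mF k : measurable (F k : set (measurableTypeR R)) by exact: closed_measurable.
    (* A countable union of closed sets need not be closed, so only finitely many [F k] are kept;
       the discarded tail has small mass by continuity from above. *)
    pose T n := \bigcup_k F k `\` \bigcup_(k in `I_n) F k.
    have mT n : measurable (T n : set (measurableTypeR R)).
      by apply: measurableD; apply: bigcup_measurable.
    have [n nT] : exists n, (mu (T n) <= (d / 2)%:E)%E.
      apply: finite_measure_decreasing => //; last by rewrite divr_gt0.
        move=> m n mn; apply/subsetPset => x [xF xm]; split=> //.
        by apply: contra_not xm => -[k km Fk]; exists k => //; exact: leq_trans km mn.
      apply/seteqP; split => // x xT; have [[k _ Fk] _] := xT 0%N I.
      by have [_] := xT k.+1 I; apply; exists k => //=.
    exists (\bigcup_k U k), (\bigcup_(k in `I_n) F k); split.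
    * exact: bigcup_open.
    * by apply: closed_bigcup => //; exact: finite_II.
    * by move=> x [k _ Fk]; exists k => //; have [_ _ FB _ _] := UF k; exact: FB.
    * by move=> x [k _ Bk]; exists k => //; have [_ _ _ BU _] := UF k; exact: BU.
    have mUF k : measurable (U k `\` F k : set (measurableTypeR R)).
      exact: measurableD.
    have mV : measurable (\bigcup_k (U k `\` F k) : set (measurableTypeR R)).
      exact: bigcupT_measurable.
    have hV : (mu (\bigcup_k (U k `\` F k)) <= (d / 2)%:E)%E.
      apply: le_trans (measure_sigma_subadditive mu mUF mV (@subset_refl _ _)) _.
      apply: le_trans (epsilon_trick0 xpredT (ltW _)); last by rewrite divr_gt0.
      by apply: lee_nneseries => // k _; have [] := UF k.
    rewrite (splitr d) EFinD; apply: le_trans (leeD hV nT).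
    apply: le_trans (measureU2 _ mV (mT n)); apply: le_measure.
    * rewrite inE; apply: measurableD; apply: bigcup_measurable => //.
    * by rewrite inE; exact: measurableU.
    * move=> x [[k _ Uk] xn]; have [Fk|Fk] := pselect (F k x).
        by right; split=> //; exists k.
      by left; exists k.
- move=> _ [x ->] d d0.
  pose T n : set (measurableTypeR R) := `]x, x + n.+1%:R^-1[%classic.
  have mT n : measurable (T n) by exact: measurable_itv.
  have [n nT] : exists n, (mu (T n) <= d%:E)%E.
    apply: finite_measure_decreasing => //.
      move=> m n mn; apply/subsetPset => y; rewrite /T /= !in_itv/= => /andP[-> h].
      apply: lt_le_trans h _; rewrite lerD2l lef_pV2 ?posrE ?ltr0n//.
      by rewrite ler_nat.
    apply/seteqP; split => // y yT; have := yT 0%N I.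
    rewrite /T /= in_itv/= => /andP[xy _].
    have yx : 0 < y - x by rewrite subr_gt0.
    have := yT (Num.truncn (y - x)^-1) I; rewrite /T /= in_itv/= => /andP[_].
    rewrite -ltrBlDl ltNge => /negP; apply.
    rewrite -[leRHS]invrK lef_pV2 ?posrE ?invr_gt0// ?ltr0n//.
    exact/ltW/truncnS_gt.
  exists `]x, +oo[%classic, `[x + n.+1%:R^-1, +oo[%classic.
  split; [exact: rray_open|exact: rray_closed| |by []|].
  + move=> y; rewrite /= !in_itv/= !andbT; apply: lt_le_trans.
    by rewrite ltrDl.
  + apply: le_trans nT; apply: le_measure; rewrite ?inE//.
      by apply: measurableD; exact: measurable_itv.
    move=> y; rewrite /T /= !in_itv/= !andbT => -[-> /negP].
    by rewrite -ltNge.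
Qed.

Local Notation lambda := ((wlength (@idfun R))^*)%mu.

(** Stated for the outer measure, since the set of energies to be covered is not known to be
    Borel. *)
Lemma lebesgue_measure_countable_balls (D : set R) (c r : R -> R)
    (B : set R) :
  countable D -> (forall x, 0 <= r x) -> B `<=` \bigcup_(x in D) ball (c x) (r x) ->
  (lambda B <= \esum_(x in D) (r x *+ 2)%:E)%E.
Proof.
move=> /countable_bijP[I]; rewrite card_eq_sym => /card_set_bijP[f bf] r0 BD.
pose G n : set R := if n \in I then ball (c (f n)) (r (f n)) else set0.
apply: (@le_trans _ _ (\sum_(0 <= n <oo) lambda (G n))%E).
  apply: le_trans (outer_measure_sigma_subadditive lambda G).
  apply: le_outer_measure => x /BD[y Dy yx].
  have [_ _ /(_ _ Dy)[n In fn]] := bf.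
  by exists n => //; rewrite /G mem_set// fn.
rewrite (reindex_esum _ _ _ _ bf) esum_mkcond -nneseries_esumT; last first.
  by move=> n; case: ifP => // _; rewrite lee_fin mulrn_wge0.
apply: lee_nneseries => [n _ _|n _]; first exact: outer_measure_ge0.
rewrite /G; case: ifP => _; last by rewrite outer_measure0.
have h : lambda (ball (c (f n)) (r (f n))) = (r (f n) *+ 2)%:E.
  exact: lebesgue_measure_ball.
by rewrite h.
Qed.

(** Regularity encloses [D] in an open set of tiny mass. Each bad energy is the centre of a ball
    inside it with mass above [c] times the radius, and the radii of a disjoint Vitali subfamily are
    summed against that mass. *)
Lemma positive_density_negligible mu (D : set (measurableTypeR R)) (c : R) :
  measurable D -> mu D = 0%E -> 0 < c ->
  (@lebesgue_measure R).-negligible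
    [set E : R | D E /\ forall r0 : R, 0 < r0 -> exists r : R, [/\ 0 < r, r <= r0 &
      c * r < fine (mu `]E - r, E + r[%classic)]].
Proof.
move=> mD D0 c0; set V := (X in negligible _ X).
apply/negligible_outer_measure; apply/eqP; rewrite eq_le outer_measure_ge0 andbT.
apply/lee_addgt0Pr => e e0; rewrite add0e.
(* A ball of radius 6r has length 12r, and the sum of the radii is at most mu(U) / c. *)
have d0 : 0 < c * e / 12 by rewrite !mulr_gt0.
have [U [F [oU cF FD DU UF]]] := finite_measure_regular mu mD d0.
have mU : measurable (U : set (measurableTypeR R)) by exact: open_measurable.
have mF : measurable (F : set (measurableTypeR R)) by exact: closed_measurable.
have muU : (mu U <= (c * e / 12)%:E)%E.
  apply: le_trans UF; rewrite -[X in (mu X <= _)%E](setDUK (subset_trans FD DU)).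
  apply: le_trans (measureU2 mu mF (measurableD mU mF)) _.
  have F0 : mu F = 0%E.
    by apply/eqP; rewrite eq_le measure_ge0 andbT -D0 le_measure ?inE.
  by rewrite [X in (X + _)%E]F0 add0e.
(* Vitali's lemma needs bounded radii, hence the cap 1, which also serves as the default outside
   [V]. *)
have /choice[r rP] (x : R) : exists r : R, [/\ 0 < r, r <= 1 & V x ->
    ball x r `<=` U /\ c * r < fine (mu (ball x r))].
  have [Vx|nVx] := pselect (V x); last by exists 1.
  have [Dx hx] := Vx.
  have /nbhs_ballP[d /= dp dU] : nbhs x U by apply: open_nbhs_nbhs; split=> //; exact: DU.
  have [|r [rp rd cr]] := hx (Num.min d 1); first by rewrite lt_min dp ltr01.
  exists r; split => //; first by apply: le_trans rd _; rewrite ge_min lexx orbT.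
  move=> _; rewrite ball_itv; split => //; rewrite -ball_itv.
  apply: subset_trans dU; apply: le_ball; apply: le_trans rd _.
  by rewrite ge_min lexx.
have rp x : 0 < r x by have [] := rP x.
have radE x : (radius (ball x (r x)))%:num = r x.
  by rewrite radius_ball_num// ltW.
have [I [cI IV tI cov]] := @vitali_lemma_infinite_cover R R
  (fun x => ball x (r x)) V 1 (fun x => is_ball_ball x (r x))
  ltac:(by move=> x; rewrite radE) ltac:(by move=> x _; rewrite radE; have [] := rP x).
(* Vitali yields closed balls of fivefold radius; the factor 6 makes room for open ones. *)
have VI : V `<=` \bigcup_(x in I) ball x (6 * r x).
  move=> x Vx; have [|y Iy] := cov x.
    by exists x => //; apply: subset_closure; exact: ballxx.
  rewrite /= scale_ballE// closure_ballE closed_ball_itv ?mulr_gt0// => xy.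
  exists y => //; rewrite ball_itv; move: xy; rewrite /= !in_itv/= => /andP[h1 h2].
  by have ry := rp y; apply/andP; split; lra.
apply: le_trans (lebesgue_measure_countable_balls cI _ VI) _.
  by move=> x; rewrite mulr_ge0// ltW.
have sumI : (\esum_(x in I) (c * r x)%:E <= mu U)%E.
  apply: (@le_trans _ _ (\esum_(x in I) mu (ball x (r x)))).
    apply: le_esum => x Ix; have [_ _ /(_ (IV _ Ix))[_ /ltW]] := rP x.
    by rewrite -lee_fin fineK// fin_num_measure//; exact: measurable_ball.
  move: cI => /countable_bijP[J]; rewrite card_eq_sym => /card_set_bijP[f bf].
  have [fI finj _] := bf.
  rewrite (reindex_esum _ _ _ _ bf) esum_mkcond -nneseries_esumT; last first.
    by move=> n; case: ifP.
  have tJ : trivIset J (fun n => ball (f n) (r (f n))).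
    move=> i j Ji Jj ij; apply: finj; rewrite ?inE//.
    apply: tI; [exact: fI..|].
    apply: subsetI_neq0 ij => y yb; exact: subset_closure.
  have mb n : J n -> measurable (ball (f n) (r (f n)) : set (measurableTypeR R)).
    by move=> _; exact: measurable_ball.
  have := measure_bigcup mu _ _ mb tJ; rewrite eseries_mkcond => <-.
  apply: le_measure; rewrite ?inE//; first exact: bigcup_measurable.
  by move=> y [n Jn yb]; have [_ _ /(_ (IV _ (fI _ Jn)))[+ _]] := rP (f n); apply.
have c12 : 0 <= 12 / c by rewrite divr_ge0// ltW.
rewrite [leLHS](_ : _ = (12 / c)%:E * \esum_(x in I) (c * r x)%:E)%E; last first.
  rewrite -esumZl//; last by move=> x; rewrite lee_fin mulr_ge0// ltW.
  apply: eq_esum => x _; rewrite -EFinM; congr EFin; field.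
  by rewrite gt_eqF.
apply: le_trans (lee_wpmul2l _ (le_trans sumI muU)) _; first by rewrite lee_fin.
rewrite -EFinM lee_fin.
by rewrite le_eqVlt; apply/orP; left; apply/eqP; field; rewrite gt_eqF.
Qed.

End ZeroDensity.

(** * Bounded solutions vanish at sites of zero spectral density *)

Section BoundedSolutions.
Context {R : realType}.
Variables (w : int -> R[i]) (v : int -> R).
Hypothesis w_decay : exists C : R, forall k : int, k != 0 ->
  cmod (w k) < C / (`|k|%:~R) ^+ 3.
Hypothesis v_bounded : exists B : R, forall n : int, `|v n| <= B.
Variable P : set R -> (int -> R[i]) -> (int -> R[i]).
Hypothesis HP : spectral_resolution (long_range_op w v) P.
Implicit Types (mu : {finite_measure set (measurableTypeR R) -> \bar R}).

Definition site (n : int) : int -> R[i] :=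
  fun k => if k == n then 1%:C else 0.

Let Re_solution_vanishes u (E : R) n mu : bounded_seq u ->
  (forall m, long_range_op w v u m = E%:C * u m) ->
  is_spectral_measure P (site n) mu -> zero_density mu E ->
  complex.Re (u n) = 0.
Proof.
move=> bu eu sp dens.
have [C C0 approx] := truncated_eigenfunction w_decay n bu eu.
apply: (zero_density_orthogonal HP _ _ _ sp C0 dens).
- by move=> u'; exact: long_range_op_ell2.
- by move=> a u1 u2 s1 s2; apply: long_range_op_comb => //; exact: ell2_bounded.
- exact: ell2_single.
move=> L /approx[psi [spsi psin psiL fL]]; exists psi; split=> //.
by rewrite rinner_single psin mulr1.
Qed.

Lemma bounded_solution_vanishes u (E : R) n mu : bounded_seq u ->
  (forall m, long_range_op w v u m = E%:C * u m) ->
  is_spectral_measure P (site n) mu -> zero_density mu E -> u n = 0.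
Proof.
move=> bu eu sp dens.
have b0 : bounded_seq (fun=> 0 : R[i]).
  by exists 0 => m; rewrite cmod_real normr0.
have e0 m : long_range_op w v (fun=> 0) m = 0.
  have := congr1 (@^~ m) (long_range_op_comb v w_decay (-1) b0 b0).
  under [in LHS]eq_fun do rewrite mulr0 addr0.
  by move=> ->; rewrite mulN1r addNr.
(* The real part of -'i u_n is the imaginary part of u_n. Adding the zero sequence puts the multiple
   in the shape of a linear combination. *)
have ciu := long_range_op_comb v w_decay (- 'i) bu b0.
have biu := bounded_seq_comb (- 'i) bu b0.
have eiu m : long_range_op w v (fun k => - 'i * u k + 0) m =
    E%:C * (- 'i * u m + 0).
  by rewrite ciu eu e0 !addr0 mulrCA.
have := Re_solution_vanishes bu eu sp dens.
have := Re_solution_vanishes biu eiu sp dens.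
case: (u n) => a b /=.
rewrite !(mul0r, mulr0, add0r, addr0, mulN1r, oppr0, sub0r) => h h'.
by apply/eqP; rewrite eq_complex /=; apply/andP; split; apply/eqP; lra.
Qed.

End BoundedSolutions.

Section EssentialSupport.
Context {R : realType}.
Implicit Types (mu : {finite_measure set (measurableTypeR R) -> \bar R}).

(** Spectral measures live on Borel sets, whereas an essential support is only Lebesgue measurable.
    Its complement is thus replaced by a Borel subset of full measure in it. *)
Lemma borel_of_lebesgue_measurable (A : set R) : lebesgue_measurable A ->
  exists B : set (measurableTypeR R), [/\ measurable B, B `<=` A &
    (@lebesgue_measure R).-negligible (A `\` B)].
Proof.
rewrite /lebesgue_measurable -completed_caratheodory_measurable.
rewrite g_sigma_completed_algebra_genE => -[B mB [N nN <-]].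
exists B; split; [by []|exact: subsetUl|].
by apply: negligibleS nN => x [[|]].
Qed.

Lemma zero_density_negligible mu (D : set (measurableTypeR R)) :
  measurable D -> mu D = 0%E ->
  (@lebesgue_measure R).-negligible [set E : R | D E /\ ~ zero_density mu E].
Proof.
move=> mD D0; pose bad (m : nat) := [set E : R | D E /\ forall r0 : R, 0 < r0 ->
  exists r : R, [/\ 0 < r, r <= r0 &
    m.+1%:R^-1 * r < fine (mu `]E - r, E + r[%classic)]].
have negbad : (@lebesgue_measure R).-negligible (\bigcup_m bad m).
  by apply: negligible_bigcup => m; apply: positive_density_negligible; rewrite ?invr_gt0.
apply: negligibleS negbad.
move=> E [DE]; apply: contra_notP => nbad d d0.
pose m := Num.truncn d^-1.
have md : m.+1%:R^-1 <= d.
  by rewrite -[leRHS]invrK lef_pV2 ?posrE ?invr_gt0// ltW// truncnS_gt.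
have [r0 r0p h] : exists2 r0 : R, 0 < r0 & forall r : R, 0 < r -> r <= r0 ->
    fine (mu `]E - r, E + r[%classic) <= m.+1%:R^-1 * r.
  apply: contrapT => hn; apply: nbad; exists m => //; split => // r0 r0p.
  apply: contrapT => hn'; apply: hn; exists r0 => // r rp rr0.
  by rewrite leNgt; apply/negP => lt; apply: hn'; exists r.
exists r0 => // r rp rr0; apply: le_trans (h r rp rr0) _.
by rewrite ler_wpM2r// ltW.
Qed.

End EssentialSupport.

Theorem corollary1p4 (R : realType) (w : int -> R[i]) (v : int -> R)
  (w_sym : forall k : int, conjc (w (- k)) = w k)
  (w_decay : exists C : R, forall k : int, k != 0 ->
    cmod (w k) < C / (`|k|%:~R) ^+ 3)
  (v_bounded : exists B : R, forall n : int, `|v n| <= B)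
  (M : set R) (M_supp : is_ac_essential_support (long_range_op w v) M)
  (S : set R) (S_meas : lebesgue_measurable S)
  (S_pos : (0 < completed_lebesgue_measure S)%E)
  (S_sol : forall E : R, S E -> exists u : int -> R[i],
    [/\ exists n : int, u n != 0,
        exists B : R, forall n : int, cmod (u n) <= B &
        forall n : int, long_range_op w v u n = E%:C * u n]) :
  completed_lebesgue_measure (S `\` M) = 0%E.
Proof.
have [lM [mu [mu_ac [max_mu ac_mu acM]]]] := M_supp.
have [P [phi [HP _ _ maximal]]] := max_mu.
have [mu_s [muE _ [N [mN N0 muN]]]] := ac_mu.
have [D0 [mD0 D0M negD0]] := borel_of_lebesgue_measurable
  (measurableC lM : lebesgue_measurable (~` M)).
(* D is a Borel part of the complement of M carrying no spectral mass. *)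
pose D := D0 `\` N.
have mD : measurable D by exact: measurableD.
have mu_acD : mu_ac D = 0%E.
  apply/acM => //; rewrite (_ : D `&` M = set0) ?measure0//.
  by apply/seteqP; split => // x [[/D0M]].
have mu_sD : mu_s D = 0%E.
  apply/eqP; rewrite eq_le measure_ge0 andbT -muN le_measure ?inE//.
    exact: measurableC.
  by move=> x [].
have muD : mu D = 0%E by rewrite muE// mu_acD mu_sD adde0.
have PVM := HP.1.
have /choice[nu nuP] (n : int) :
    exists nu : {finite_measure set (measurableTypeR R) -> \bar R},
    is_spectral_measure P (site n) nu.
  by apply: (pvm_measure PVM); exact: ell2_single.
(* Maximality of [mu] transfers its null set to the spectral measure of every site. *)
have nuD n : nu n D = 0%E.
  have /null_content_dominatesP := maximal _ _ (ell2_single n _) (nuP n).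
  by apply.
pose bad n := [set E : R | D E /\ ~ zero_density (nu n) E].
have negbad n : (@lebesgue_measure R).-negligible (bad n).
  exact: zero_density_negligible.
suff : (@lebesgue_measure R).-negligible (S `\` M).
  by move/negligible_outer_measure.
(* Z is null, and off Z every spectral measure nu n has zero density on S \ M. *)
pose Z := ((~` M `\` D0) `|` N) `|`
  ((\bigcup_k bad (Posz k)) `|` (\bigcup_k bad (Negz k))).
have negZ : (@lebesgue_measure R).-negligible Z.
  apply: negligibleU; apply: negligibleU => //.
  - by exists N; split.
  - exact: negligible_bigcup.
  - exact: negligible_bigcup.
apply: negligibleS negZ => E [SE ME]; apply: contrapT => nZ.
have DE : D E.
  split; apply: contrapT => h; apply: nZ; left; [left|right] => //.
  exact: contrapT.
have dens n : zero_density (nu n) E.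
  apply: contrapT => h; apply: nZ; right.
  by case: n h => k h; [left|right]; exists k.
have [u [[n un] bu eu]] := S_sol E SE.
have un0 := bounded_solution_vanishes w_decay v_bounded HP bu eu (nuP n) (dens n).
by rewrite un0 eqxx in un.
Qed.
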